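(* Let $R>0$ and let $u\in C^4(B_R(0))$, $B_R(0)\subset\mathbb{R}^2$, be a convex solution of the Monge–Ampère equation $$\det D^2u=f(x)\quad\text{in } B_R(0),$$ where $f$ is a $C^2$ function satisfying $0<m\le f\le M$ in $B_R(0)$ for constants $0<m\le M$. Then $$|D^2u(0)|\le C_1\exp\Big(C_2\,\frac{\sup_{B_R(0)}|Du|^2}{R^2}\Big),$$ where $C_1>0$ depends only on $m$, $M$, $R\sup_{B_R(0)}|\nabla f|$ and $R^2\sup_{B_R(0)}|\nabla^2 f|$, and $C_2>0$ depends only on $m$ and $M$.
   Context: $|D^2u(0)|$ denotes a norm of the Hessian matrix at the origin (e.g. its largest eigenvalue, which for convex $u$ controls all entries). *)

(* Defs.v *)
From Stdlib Require Import Reals.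
Open Scope R_scope.

Definition ball0 (r x y : R) : Prop := x * x + y * y < r * r.

Definition cont_on (U : R -> R -> Prop) (g : R -> R -> R) : Prop :=
  forall x y, U x y -> forall eps, 0 < eps -> exists d, 0 < d /\
    forall x' y', U x' y' -> (x' - x) ^ 2 + (y' - y) ^ 2 < d ^ 2 ->
      Rabs (g x' y' - g x y) < eps.

Definition dx_on (U : R -> R -> Prop) (g gx : R -> R -> R) : Prop :=
  forall x y, U x y -> derivable_pt_lim (fun t => g t y) x (gx x y).
Definition dy_on (U : R -> R -> Prop) (g gy : R -> R -> R) : Prop :=
  forall x y, U x y -> derivable_pt_lim (fun t => g x t) y (gy x y).

Fixpoint Ck (k : nat) (U : R -> R -> Prop) (g : R -> R -> R) : Prop :=
  match k with
  | O => cont_on U g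
  | S k' => cont_on U g /\ exists gx gy, dx_on U g gx /\ dy_on U g gy /\
              Ck k' U gx /\ Ck k' U gy
  end.

Definition convex_on (U : R -> R -> Prop) (u : R -> R -> R) : Prop :=
  forall x1 y1 x2 y2 t, U x1 y1 -> U x2 y2 -> 0 <= t <= 1 ->
    u (t * x1 + (1 - t) * x2) (t * y1 + (1 - t) * y2)
      <= t * u x1 y1 + (1 - t) * u x2 y2.

(* largest eigenvalue of the symmetric matrix [[a, b], [b, c]] *)
Definition sym_max_eig (a b c : R) : R :=
  (a + c) / 2 + sqrt (((a - c) / 2) ^ 2 + b ^ 2).

(* operator (spectral) norm of the symmetric matrix [[a, b], [b, c]] *)
Definition sym_op_norm (a b c : R) : R :=
  Rabs ((a + c) / 2) + sqrt (((a - c) / 2) ^ 2 + b ^ 2).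

(* Main.v *)
Require Import Defs.
From Stdlib Require Import Reals Lra Lia Psatz Classical ClassicalEpsilon.
From Coquelicot Require Import Coquelicot.
Open Scope R_scope.
Set Bullet Behavior "Strict Subproofs".

(** Scale to the unit ball and apply the maximum principle to
      phi = s (1/8 - Q)_+^4 (1/8 - P)_+^4 exp (C0 |Du|^2 / 2),   C0 = 73 / m,
    where s is the trace of D^2u, Q = <x, cof(D^2u) x> / s and P = |x|^2 - Q.
    When the eigenvalues are lam >> mu, with eigenvectors e1 and e2, Q and P are
    close to <x, e2>^2 and <x, e1>^2, so the cut-off is adapted to the
    eigenframe, while all the ingredients stay smooth where the eigenvalues
    cross.  The support of phi lies in |x| < 1/2.

    At a maximum point write L = mu d_11 + lam d_22 in the eigenframe.  Then
    L (|Du|^2 / 2) is about f lam, the third order terms of L (log s) have a good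
    sign, and those of L Q cancel to leading order thanks to the differentiated
    equation.  In direction e2 the bad term -8 lam / w, w = 1/8 - Q, is beaten by
    lam (u_112 / lam)^2, which the first order condition makes comparable to
    64 lam x2^2 / w^2, together with C0 f lam.  Hence L (log phi) > 0 unless
    lam (1/8 - Q)^2 (1/8 - P)^2 is bounded by a multiple of (1 + sup |Du|)^2. *)

(** A radial cut-off [eta] would contribute about [-lam / eta] to [L log phi]. Where [x] is parallel
    to [e1], the first order condition in direction [e2] gives nothing against this, and [C0 f lam]
    does not grow as [eta] tends to 0. With [Q] in place of [|x|^2], [w] can be small only where
    [x2^2] is close to 1/8, and there the gain [64 lam x2^2 / w^2] dominates [lam / w]. For [P] the
    contributions of size [lam] to [L P] cancel, because [L |x|^2 = 2 lam + 2 mu]; up to error terms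
    its cut-off costs only terms weighted by [mu = f / lam].

    With exponent [N] on the cut-offs, [lam (u_112 / lam)^2] is about [4 N^2 lam x2^2 / w^2], while
    the square of the gradient of [w] costs [4 N lam x2^2 / w^2]. Half of the former is reserved for
    the errors, so [N > 2] is required; [N = 4] also leaves room for Young's inequality. For [w]
    away from 0 the gain may vanish ([x2 = 0]), and the loss, then a bounded multiple of [lam], is
    paid by [C0 f lam]. This forces [C0 f] above a fixed number, and is the origin of the
    exponential of [|Du|^2]. *)

(** * Pointwise estimate *)

(* [h] is a small parameter, [L] a large one: [e = O(h^j L^i)] with constant [C]. *)
Definition graded (h L : R) (j i : nat) (C e : R) : Prop :=
  0 <= C /\ Rabs e <= C * h ^ j * L ^ i.

Lemma pow_unit_antitone (h : R) (i j : nat) :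
  0 <= h <= 1 -> (i <= j)%nat -> h ^ j <= h ^ i.
Proof.
  intros Hh Hij. replace j with (i + (j - i))%nat by lia.
  rewrite pow_add.
  assert (0 <= h ^ i) by (apply pow_le; lra).
  assert (h ^ (j - i) <= 1) by (rewrite <- (pow1 (j - i)); apply pow_incr; lra).
  nra.
Qed.

Section Graded.
Variables (h L : R).
Hypothesis Hh : 0 <= h <= 1.
Hypothesis HL : 1 <= L.

Lemma graded_weaken j i j' i' C e :
  graded h L j i C e -> (j' <= j)%nat -> (i <= i')%nat -> graded h L j' i' C e.
Proof.
  intros [HC He] Hj Hi; split; [exact HC|].
  eapply Rle_trans; [exact He|].
  assert (0 <= h ^ j) by (apply pow_le; lra).
  assert (0 <= L ^ i) by (apply pow_le; lra).
  apply Rmult_le_compat; auto.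
  - now apply Rmult_le_pos.
  - apply Rmult_le_compat_l; [lra|now apply pow_unit_antitone].
  - now apply Rle_pow.
Qed.

Lemma graded_plus j1 i1 C1 e1 j2 i2 C2 e2 :
  graded h L j1 i1 C1 e1 -> graded h L j2 i2 C2 e2 ->
  graded h L (min j1 j2) (max i1 i2) (C1 + C2) (e1 + e2).
Proof.
  intros H1 H2.
  apply (graded_weaken _ _ (min j1 j2) (max i1 i2)) in H1; [|lia|lia].
  apply (graded_weaken _ _ (min j1 j2) (max i1 i2)) in H2; [|lia|lia].
  destruct H1 as [P1 H1], H2 as [P2 H2]; split; [lra|].
  eapply Rle_trans; [apply Rabs_triang|lra].
Qed.

Lemma graded_opp j i C e : graded h L j i C e -> graded h L j i C (- e).
Proof. intros [P H]; split; [|rewrite Rabs_Ropp]; assumption. Qed.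

Lemma graded_minus j1 i1 C1 e1 j2 i2 C2 e2 :
  graded h L j1 i1 C1 e1 -> graded h L j2 i2 C2 e2 ->
  graded h L (min j1 j2) (max i1 i2) (C1 + C2) (e1 - e2).
Proof. intros; apply graded_plus; [|apply graded_opp]; assumption. Qed.

Lemma graded_mult j1 i1 C1 e1 j2 i2 C2 e2 :
  graded h L j1 i1 C1 e1 -> graded h L j2 i2 C2 e2 ->
  graded h L (j1 + j2) (i1 + i2) (C1 * C2) (e1 * e2).
Proof.
  intros [P1 H1] [P2 H2]; split; [nra|].
  rewrite Rabs_mult, !pow_add.
  replace (C1 * C2 * (h ^ j1 * h ^ j2) * (L ^ i1 * L ^ i2))
    with ((C1 * h ^ j1 * L ^ i1) * (C2 * h ^ j2 * L ^ i2)) by ring.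
  apply Rmult_le_compat; auto using Rabs_pos.
Qed.

Lemma graded_pow j i C e p :
  graded h L j i C e -> graded h L (p * j) (p * i) (C ^ p) (e ^ p).
Proof.
  intros H. induction p as [|p IH]; cbn [Nat.mul pow].
  - split; [lra|]. rewrite Rabs_R1; simpl; lra.
  - now apply graded_mult.
Qed.

Lemma graded_const c : 0 <= c -> graded h L 0 0 c c.
Proof. intros Hc; split; [exact Hc|]. rewrite Rabs_pos_eq; simpl; lra. Qed.

Lemma graded_base : graded h L 1 0 1 h.
Proof. split; [lra|]. rewrite Rabs_pos_eq; simpl; lra. Qed.

Lemma graded_bounded B e : Rabs e <= B -> graded h L 0 0 B e.
Proof. intros H; split; [pose proof (Rabs_pos e)|simpl]; lra. Qed.

Lemma graded_linear e : Rabs e <= L -> graded h L 0 1 1 e.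
Proof. intros H; split; simpl; lra. Qed.

End Graded.

Ltac graded_tac :=
  lazymatch goal with
  | |- graded _ _ _ _ _ (_ + _) => eapply graded_plus; [assumption|assumption|graded_tac|graded_tac]
  | |- graded _ _ _ _ _ (_ - _) => eapply graded_minus; [assumption|assumption|graded_tac|graded_tac]
  | |- graded _ _ _ _ _ (- _) => eapply graded_opp; graded_tac
  | |- graded _ _ _ _ _ (_ * _) => eapply graded_mult; graded_tac
  | |- graded _ _ _ _ _ (_ ^ _) => eapply graded_pow; graded_tac
  | |- graded ?h _ _ _ _ ?e =>
      first [ constr_eq h e; eapply graded_base; assumption
            | eapply graded_bounded; eassumption
            | eapply graded_linear; assumption
            | eapply graded_const; lra ]
  end.

(* Normal forms, at a point where D^2u = diag(lam, mu), in the variables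
     h = lam^(-1/2), n = f^(1/2), ni = 1/n, S = lam / (lam + mu),
     X = mu^(1/2) u_111 / lam, Y = lam^(1/2) u_112 / lam;
   the differentiated equation then gives u_122 = h c_red and
   u_222 = f2 h^2 - n^2 h^3 Y, and one has
     Q_1 = h Q1_red,  Q_2 = 2 y + h^3 Q2_red,  L Q = 2 lam + LQ_err,
     L (log s) = X^2 + Y^2 + Llogs_err,  s_2 / s = h Y + h logs2_err.
   No negative power of [h] is left, so [graded_tac] can bound them. *)
Section Expansions.
Variables (h n ni S X Y x y f1 f2 f11 f12 f22 : R).

Definition Q1_red : R :=
  (f1 * h ^ 3 - 2 * n * X * h ^ 2) * (x ^ 2 - y ^ 2) * S ^ 2
  - 2 * Y * S * x * y + 2 * n ^ 2 * h ^ 3 * S * x.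
Definition Q2_red : R :=
  (f2 - 2 * n ^ 2 * h * Y) * (x ^ 2 - y ^ 2) * h * S ^ 2
  - 2 * (f1 * h - n * X) * S * x * y - 2 * n ^ 2 * h * S * y.
Definition s1_err : R := f1 * h ^ 5 * S - n * h ^ 4 * X * S.
Definition s2_err : R := f2 * h ^ 3 * S - n ^ 2 * h ^ 4 * Y * S.
Definition c_red : R := f1 * h - n * X.

Definition LQ_err : R :=
  (x ^ 2 - y ^ 2) * S ^ 2 *
    (h ^ 2 * f22 - n ^ 2 * h ^ 6 * f11 + 2 * h ^ 5 * f1 * c_red
     - 2 * h ^ 3 * Y * f2)
  - 2 * x * y * S * (h ^ 2 * f12 + h ^ 3 * Y * f1 - h * X * ni * f2)
  + (2 * n ^ 2 * h ^ 2 - 4 * n ^ 2 * h ^ 2 * S)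
  - 4 * y * S * f2 * h ^ 2
  - 4 * x * S * (1 - n ^ 2 * h ^ 4) * (h * c_red)
  - 2 * h * Q2_red * (h * Y * S + h * s2_err)
  - 2 * n ^ 2 * h ^ 2 * Q1_red * (X * ni * S + s1_err).

Definition Llogs_err : R :=
  h ^ 2 * S * (f11 + f22) + 2 * h ^ 4 * S * c_red ^ 2 - 2 * S * ni * f1 * h * X
  - 2 * S * Y * (f2 * h ^ 3 - n ^ 2 * h ^ 4 * Y)
  - X ^ 2 * (n ^ 2 * h ^ 4 * S) ^ 2 - Y ^ 2 * (n ^ 2 * h ^ 4 * S) ^ 2
  - (n ^ 2 * (2 * X * ni * S * s1_err + s1_err ^ 2)
     + 2 * Y * S * s2_err + s2_err ^ 2).

Definition logs2_err : R := s2_err - n ^ 2 * h ^ 4 * S * Y.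
End Expansions.

Lemma expansion_bounds (B : R) :
  exists C : R, 0 < C /\
  forall h n ni S X Y x y f1 f2 f11 f12 f22 L : R,
  0 <= h <= 1 -> 1 <= L -> Rabs X <= L -> Rabs Y <= L ->
  Rabs n <= B -> Rabs ni <= B -> Rabs S <= B -> Rabs x <= B -> Rabs y <= B ->
  Rabs f1 <= B -> Rabs f2 <= B ->
  Rabs f11 <= B -> Rabs f12 <= B -> Rabs f22 <= B ->
  Rabs (Q1_red h n S X Y x y f1) <= C * L /\
  Rabs (Q2_red h n S X Y x y f1 f2) <= C * L /\
  Rabs (LQ_err h n ni S X Y x y f1 f2 f11 f12 f22) <= C * h * L ^ 2 /\
  Rabs (Llogs_err h n ni S X Y f1 f2 f11 f22) <= C * h * L ^ 2 /\
  Rabs (logs2_err h n S Y f2) <= C * h ^ 3 * L.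
Proof.
  assert (H : exists C1 C2 C3 C4 C5 : R,
    forall h n ni S X Y x y f1 f2 f11 f12 f22 L : R,
  0 <= h <= 1 -> 1 <= L -> Rabs X <= L -> Rabs Y <= L ->
  Rabs n <= B -> Rabs ni <= B -> Rabs S <= B -> Rabs x <= B -> Rabs y <= B ->
  Rabs f1 <= B -> Rabs f2 <= B ->
  Rabs f11 <= B -> Rabs f12 <= B -> Rabs f22 <= B ->
  graded h L 0 1 C1 (Q1_red h n S X Y x y f1) /\
  graded h L 0 1 C2 (Q2_red h n S X Y x y f1 f2) /\
  graded h L 1 2 C3 (LQ_err h n ni S X Y x y f1 f2 f11 f12 f22) /\
  graded h L 1 2 C4 (Llogs_err h n ni S X Y f1 f2 f11 f22) /\
  graded h L 3 1 C5 (logs2_err h n S Y f2)).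
  (* The five constants are created before the variables are introduced, so they can depend on [B]
     only. For [X] and [Y] this excludes [L] as a constant and sends [graded_tac] on to
     [graded_linear]. *)
  { do 5 eexists. intros.
    unfold LQ_err, Llogs_err, logs2_err, Q1_red, Q2_red, c_red, s1_err, s2_err.
    refine (conj _ (conj _ (conj _ (conj _ _)))).
    all: eapply graded_weaken;
      [assumption|assumption|graded_tac|cbn; lia|cbn; lia]. }
  destruct H as (C1 & C2 & C3 & C4 & C5 & H).
  set (D := Rabs C1 + Rabs C2 + Rabs C3 + Rabs C4 + Rabs C5 + 1).
  pose proof (Rabs_pos C1); pose proof (Rabs_pos C2); pose proof (Rabs_pos C3).
  pose proof (Rabs_pos C4); pose proof (Rabs_pos C5).
  pose proof (Rle_abs C1); pose proof (Rle_abs C2); pose proof (Rle_abs C3).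
  pose proof (Rle_abs C4); pose proof (Rle_abs C5).
  exists D; split; [unfold D; lra|].
  intros h n ni S X Y x y f1 f2 f11 f12 f22 L Hh HL HX HY Hn Hni HS Hx Hy
    Hf1 Hf2 Hf11 Hf12 Hf22.
  destruct (H h n ni S X Y x y f1 f2 f11 f12 f22 L Hh HL HX HY Hn Hni HS Hx Hy
    Hf1 Hf2 Hf11 Hf12 Hf22) as ([_ E1] & [_ E2] & [_ E3] & [_ E4] & [_ E5]).
  assert (mono : forall C T, 0 <= T -> C <= D -> C * T <= D * T)
    by (intros; apply Rmult_le_compat_r; assumption).
  assert (0 <= h * L ^ 2) by (apply Rmult_le_pos; [lra|apply pow_le; lra]).
  assert (0 <= h ^ 3 * L) by (apply Rmult_le_pos; [apply pow_le|]; lra).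
  clear H.
  repeat apply conj; (eapply Rle_trans; [eassumption|]).
  - replace (C1 * h ^ 0 * L ^ 1) with (C1 * L) by ring. apply mono; unfold D; lra.
  - replace (C2 * h ^ 0 * L ^ 1) with (C2 * L) by ring. apply mono; unfold D; lra.
  - rewrite pow_1, !Rmult_assoc. apply mono; unfold D; lra.
  - rewrite pow_1, !Rmult_assoc. apply mono; unfold D; lra.
  - rewrite pow_1, !Rmult_assoc. apply mono; unfold D; lra.
Qed.

(** * The contradiction in normal form *)

Ltac nonneg :=
  lazymatch goal with
  | |- 0 <= _ ^ 2 => apply pow2_ge_0
  | |- 0 <= _ * _ => apply Rmult_le_pos; nonneg
  | _ => lra
  end.

Lemma sqr_le_of_Rabs_le (e b : R) : Rabs e <= b -> e ^ 2 <= b ^ 2.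
Proof.
  intros H. rewrite <- (pow2_abs e). apply pow_incr. split; [apply Rabs_pos|exact H].
Qed.

Lemma Rabs_le_of_sqr_le (e b : R) : 0 <= b -> e ^ 2 <= b ^ 2 -> Rabs e <= b.
Proof. intros Hb H. apply Rabs_le. split; nra. Qed.

(** The core of the maximum principle, with [k = lam^(1/2)] and [q = Q_2 - 2 y]. The smallness of
    [h] against [w v] is the negation of the bound to be proved; the last two hypotheses are the
    first order condition in direction [e2] and [L (log phi) <= 0]. *)
Lemma reduced_contradiction (m M A B : R) :
  0 < m -> m <= M -> 0 <= A -> 0 <= B ->
  exists eps : R, 0 < eps /\
  forall h n ni S X Y x y f1 f2 f11 f12 f22 u1 u2 w v K k : R,
  0 < h -> h * k = 1 -> 0 < n -> n * ni = 1 -> S * (1 + n ^ 2 * h ^ 4) = 1 ->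
  m <= n ^ 2 <= M -> Rabs x <= 1 / 2 -> Rabs y <= 1 / 2 ->
  Rabs f1 <= A -> Rabs f2 <= A ->
  Rabs f11 <= B -> Rabs f12 <= B -> Rabs f22 <= B ->
  Rabs u1 <= K -> Rabs u2 <= K ->
  0 < w <= 1 / 4 -> 0 < v <= 1 / 4 ->
  w = 1 / 8 - (y ^ 2 + n ^ 2 * h ^ 4 * S * (x ^ 2 - y ^ 2)) ->
  h * (1 + K) <= eps * (w * v) ->
  let q := h ^ 3 * Q2_red h n S X Y x y f1 f2 in
  let Q1 := h * Q1_red h n S X Y x y f1 in
  h * Y + h * logs2_err h n S Y f2
    = 4 * (2 * y + q) / w - 4 * q / v - 73 / m * u2 * (n ^ 2 * h ^ 2) ->
  X ^ 2 + Y ^ 2 + Llogs_err h n ni S X Y f1 f2 f11 f22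
  - 4 * (2 * k ^ 2 + LQ_err h n ni S X Y x y f1 f2 f11 f12 f22) / w
  - 4 * (n ^ 2 * h ^ 2 * Q1 ^ 2 + k ^ 2 * (2 * y + q) ^ 2) / w ^ 2
  + 4 * (LQ_err h n ni S X Y x y f1 f2 f11 f12 f22 - 2 * (n ^ 2 * h ^ 2)) / v
  - 4 * (n ^ 2 * h ^ 2 * (Q1 - 2 * x) ^ 2 + k ^ 2 * q ^ 2) / v ^ 2
  + 73 / m * (n ^ 2 * (k ^ 2 + n ^ 2 * h ^ 2) + (u1 * f1 + u2 * f2)) <= 0 ->
  False.
Proof.
  intros Hm HmM HA HB.
  set (C0 := 73 / m).
  assert (HC0 : 0 < C0) by (apply Rdiv_lt_0_compat; lra).
  assert (HC0m : C0 * m = 73) by (unfold C0; field; lra).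
  set (Bd := 1 + A + B + (1 + M) + (1 + / m)).
  assert (Him : 0 < / m) by now apply Rinv_0_lt_compat.
  destruct (expansion_bounds Bd) as (C & HC & bounds).
  set (D := 27 * C + 36 * M * C ^ 2 + 1000 * C ^ 2 + 17 * M + 5 * (C0 * M) ^ 2 + 1).
  assert (HD : 1 <= D).
  { unfold D. assert (0 <= M * C ^ 2) by nra. nra. }
  (* With [eps = 1 / E], the term [2 D] gives [D eps <= 1/2], so that half of [X^2 + Y^2] absorbs
     all the errors. Moreover [k >= E (1 + K)], so that [k^2] beats the gradient term [2 C0 K A]. *)
  set (E := 2 * D + 2 * C0 * A).
  assert (HE : 2 <= E) by (unfold E; nra).
  exists (/ E). split; [apply Rinv_0_lt_compat; lra|].
  intros h n ni S X Y x y f1 f2 f11 f12 f22 u1 u2 w v K k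
    Hh Hhk Hn Hni HS HnM Hx Hy Hf1 Hf2 Hf11 Hf12 Hf22 Hu1 Hu2 Hw Hv Hwdef Hsmall
    q Q1 HY Hsum.
  set (eps := / E) in *.
  assert (HepsE : eps * E = 1) by (unfold eps; field; lra).
  assert (Heps : 0 < eps) by (unfold eps; apply Rinv_0_lt_compat; lra).
  assert (Heps1 : eps <= 1 / 2) by nra.
  assert (HK : 0 <= K) by (pose proof (Rabs_pos u1); lra).
  set (t := / w). set (r := / v).
  assert (Ht : w * t = 1) by (unfold t; field; lra).
  assert (Hr : v * r = 1) by (unfold r; field; lra).
  assert (Ht0 : 0 < t) by (unfold t; apply Rinv_0_lt_compat; lra).
  assert (Hr0 : 0 < r) by (unfold r; apply Rinv_0_lt_compat; lra).
  assert (Hk0 : 0 < k) by nra.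
  assert (wv1 : w * v <= 1) by nra.
  assert (hK : h * (1 + K) <= eps) by nra.
  assert (h1 : h <= eps) by nra.
  (* Every factor [1 / w] or [1 / v] in an error term is paid for by one power of [h]. *)
  assert (ht : h * t <= eps).
  { replace eps with (eps * w * t) by (rewrite Rmult_assoc, Ht; ring).
    apply Rmult_le_compat_r; nra. }
  assert (hr : h * r <= eps).
  { replace eps with (eps * v * r) by (rewrite Rmult_assoc, Hr; ring).
    apply Rmult_le_compat_r; nra. }
  set (L := 1 + Rabs X + Rabs Y).
  pose proof (Rabs_pos X) as HX0. pose proof (Rabs_pos Y) as HY0.
  set (Z := 1 + X ^ 2 + Y ^ 2).
  assert (HLZ : L ^ 2 <= 3 * Z).
  { unfold L, Z. rewrite <- (pow2_abs X), <- (pow2_abs Y).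
    pose proof (pow2_ge_0 (Rabs X - Rabs Y)).
    pose proof (pow2_ge_0 (1 - Rabs Y)). pose proof (pow2_ge_0 (1 - Rabs X)). nra. }
  assert (HZ : 1 <= Z) by (unfold Z; nra).
  assert (HS01 : 0 < S <= 1).
  { assert (0 <= n ^ 2 * h ^ 4).
    { apply Rmult_le_pos; apply pow_le; lra. }
    assert (0 < S) by nra. split; nra. }
  assert (nB : Rabs n <= Bd).
  { rewrite Rabs_pos_eq by lra. unfold Bd.
    assert (n <= 1 + M) by nra. lra. }
  assert (niB : Rabs ni <= Bd).
  { assert (0 < ni) by nra. rewrite Rabs_pos_eq by lra. unfold Bd.
    assert (ni ^ 2 <= / m).
    { apply Rmult_le_reg_l with m; [lra|].
      rewrite Rinv_r by lra.
      replace 1 with (n ^ 2 * ni ^ 2) by (rewrite <- Rpow_mult_distr, Hni; ring).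
      apply Rmult_le_compat_r; [apply pow2_ge_0|lra]. }
    assert (ni <= 1 + / m) by nra. lra. }
  assert (HL1 : 1 <= L) by (unfold L; lra).
  assert (HXL : Rabs X <= L) by (unfold L; lra).
  assert (HYL : Rabs Y <= L) by (unfold L; lra).
  assert (SB : Rabs S <= Bd) by (rewrite Rabs_pos_eq by lra; unfold Bd; lra).
  assert (half : 1 / 2 <= Bd) by (unfold Bd; lra).
  assert (ABd : A <= Bd) by (unfold Bd; lra).
  assert (BBd : B <= Bd) by (unfold Bd; lra).
  destruct (bounds h n ni S X Y x y f1 f2 f11 f12 f22 L)
    as (b1 & b2 & b3 & b4 & b5); try assumption; try (eapply Rle_trans; eassumption).
  { split; lra. }
  clear bounds.
  set (rho := LQ_err h n ni S X Y x y f1 f2 f11 f12 f22) in *.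
  set (rhs := Llogs_err h n ni S X Y f1 f2 f11 f22) in *.
  set (Q1r := Q1_red h n S X Y x y f1) in *.
  set (Q2r := Q2_red h n S X Y x y f1 f2) in *.
  set (e2 := logs2_err h n S Y f2) in *.
  apply sqr_le_of_Rabs_le in b1, b2.
  assert (CL2 : (C * L) ^ 2 <= 3 * C ^ 2 * Z).
  { rewrite Rpow_mult_distr. assert (0 <= C ^ 2) by apply pow2_ge_0. clear - H HLZ; nra. }
  assert (eps2 : eps ^ 2 <= eps) by (clear - Heps Heps1; nra).
  assert (CZ : 0 <= C * Z) by (apply Rmult_le_pos; lra).
  assert (rate : forall g, 0 <= g -> g * h <= eps -> g * (C * h * L ^ 2) <= 3 * C * eps * Z).
  { intros g Hg Hgh.
    replace (g * (C * h * L ^ 2)) with (C * (g * h) * L ^ 2) by ring.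
    replace (3 * C * eps * Z) with (C * eps * (3 * Z)) by ring.
    apply Rmult_le_compat; [|apply pow2_ge_0| |exact HLZ].
    { nonneg. }
    apply Rmult_le_compat_l; lra. }
  assert (e_s : - (3 * C * eps * Z) <= rhs).
  { pose proof (rate 1). apply Rabs_le_between in b4. lra. }
  assert (e_t : rho * t <= 3 * C * eps * Z).
  { eapply Rle_trans; [apply Rle_abs|].
    rewrite Rabs_mult, (Rabs_pos_eq t), Rmult_comm by lra.
    eapply Rle_trans; [apply Rmult_le_compat_l; [lra|exact b3]|].
    apply rate; lra. }
  assert (e_r : - (3 * C * eps * Z) <= rho * r).
  { assert (Rabs (rho * r) <= 3 * C * eps * Z).
    { rewrite Rabs_mult, (Rabs_pos_eq r), Rmult_comm by lra.
      eapply Rle_trans; [apply Rmult_le_compat_l; [lra|exact b3]|].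
      apply rate; lra. }
    apply Rabs_le_between in H; lra. }
  assert (sq : forall g, 0 <= g <= eps -> g ^ 2 <= eps) by (clear - Heps1; intros; nra).
  assert (h1' : h ^ 2 <= 1) by (clear - Hh h1 Heps1; nra).
  assert (C2Z : 0 <= 3 * C ^ 2 * Z) by (apply Rmult_le_pos; [apply Rmult_le_pos; [lra|apply pow2_ge_0]|lra]).
  assert (aux : forall g1 g2 T, 0 <= g1 <= 1 -> 0 <= g2 <= eps -> 0 <= T <= 3 * C ^ 2 * Z ->
            g1 * g2 * T <= 3 * C ^ 2 * eps * Z).
  { intros g1 g2 T [] [] [].
    replace (3 * C ^ 2 * eps * Z) with (1 * eps * (3 * C ^ 2 * Z)) by ring.
    apply Rmult_le_compat; try assumption; [now apply Rmult_le_pos|]. apply Rmult_le_compat; assumption. }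
  assert (ht0 : 0 <= h * t) by (apply Rmult_le_pos; lra).
  assert (hr0 : 0 <= h * r) by (apply Rmult_le_pos; lra).
  assert (Q1r2 : 0 <= Q1r ^ 2 <= 3 * C ^ 2 * Z) by (split; [apply pow2_ge_0|lra]).
  assert (Q2r2 : 0 <= Q2r ^ 2 <= 3 * C ^ 2 * Z) by (split; [apply pow2_ge_0|lra]).
  assert (hte : 0 <= (h * t) ^ 2 <= eps) by (split; [apply pow2_ge_0|apply sq; lra]).
  assert (hre : 0 <= (h * r) ^ 2 <= eps) by (split; [apply pow2_ge_0|apply sq; lra]).
  assert (h2 : 0 <= h ^ 2 <= 1) by (split; [apply pow2_ge_0|lra]).
  assert (e_q1t : n ^ 2 * h ^ 2 * Q1 ^ 2 * t ^ 2 <= M * (3 * C ^ 2 * eps * Z)).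
  { replace (n ^ 2 * h ^ 2 * Q1 ^ 2 * t ^ 2)
      with (n ^ 2 * (h ^ 2 * (h * t) ^ 2 * Q1r ^ 2)) by (unfold Q1; ring).
    apply Rmult_le_compat; [apply pow2_ge_0| |lra|now apply aux].
    nonneg. }
  assert (e_q1r : n ^ 2 * h ^ 2 * (Q1 - 2 * x) ^ 2 * r ^ 2
                   <= 2 * M * (3 * C ^ 2 * eps * Z) + 2 * M * eps).
  { assert (H1 : n ^ 2 * (h ^ 2 * (h * r) ^ 2 * Q1r ^ 2) <= M * (3 * C ^ 2 * eps * Z)).
    { apply Rmult_le_compat; [apply pow2_ge_0| |lra|now apply aux].
      nonneg. }
    assert (H2 : n ^ 2 * (h * r) ^ 2 <= M * eps).
    { apply Rmult_le_compat; apply pow2_ge_0 || lra. }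
    assert (H3 : (Q1 - 2 * x) ^ 2 <= 2 * Q1 ^ 2 + 2).
    { apply Rabs_le_between in Hx. pose proof (pow2_ge_0 (Q1 + 2 * x)). clear - Hx H; nra. }
    assert (H4 : 0 <= n ^ 2 * h ^ 2 * r ^ 2)
      by (nonneg).
    apply Rle_trans with ((n ^ 2 * h ^ 2 * r ^ 2) * (2 * Q1 ^ 2 + 2)).
    { apply Rle_trans with ((n ^ 2 * h ^ 2 * r ^ 2) * (Q1 - 2 * x) ^ 2); [right; ring|].
      now apply Rmult_le_compat_l. }
    replace ((n ^ 2 * h ^ 2 * r ^ 2) * (2 * Q1 ^ 2 + 2))
      with (2 * (n ^ 2 * (h ^ 2 * (h * r) ^ 2 * Q1r ^ 2)) + 2 * (n ^ 2 * (h * r) ^ 2))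
      by (unfold Q1; ring).
    lra. }
  assert (kq : k ^ 2 * q ^ 2 = h ^ 4 * Q2r ^ 2).
  { unfold q. replace (k ^ 2 * (h ^ 3 * Q2r) ^ 2) with ((h * k) ^ 2 * (h ^ 4 * Q2r ^ 2)) by ring.
    rewrite Hhk. ring. }
  assert (e_qt : k ^ 2 * q ^ 2 * t ^ 2 <= 3 * C ^ 2 * eps * Z).
  { rewrite kq. replace (h ^ 4 * Q2r ^ 2 * t ^ 2) with (h ^ 2 * (h * t) ^ 2 * Q2r ^ 2) by ring.
    now apply aux. }
  assert (e_qr : k ^ 2 * q ^ 2 * r ^ 2 <= 3 * C ^ 2 * eps * Z).
  { rewrite kq. replace (h ^ 4 * Q2r ^ 2 * r ^ 2) with (h ^ 2 * (h * r) ^ 2 * Q2r ^ 2) by ring.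
    now apply aux. }
  assert (e_mu : n ^ 2 * h ^ 2 * r <= M * eps).
  { replace (n ^ 2 * h ^ 2 * r) with (n ^ 2 * (h * (h * r))) by ring.
    apply Rmult_le_compat; [apply pow2_ge_0|apply Rmult_le_pos; lra|lra|].
    clear - ht0 hr0 hr Hh h1 Heps1; nra. }
  (* The first order condition, multiplied by [k = 1 / h] and solved for [Y], has the leading part
     [8 y k / w]; [W] is the remainder, with [W^2] of order [eps Z]. *)
  set (W := 4 * (h * (h * t)) * Q2r - 4 * (h * (h * r)) * Q2r - C0 * u2 * n ^ 2 * h - e2).
  assert (HYW : Y = 8 * y * t * k + W).
  { assert (Y = k * (h * Y + h * e2) - e2).
    { replace (k * (h * Y + h * e2)) with ((h * k) * (Y + e2)) by ring.
      rewrite Hhk; ring. }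
    rewrite H, HY. unfold W, q, Rdiv. fold t r C0.
    apply Rminus_diag_uniq.
    transitivity ((h * k - 1)
      * (4 * h ^ 2 * Q2r * t - 4 * h ^ 2 * Q2r * r - C0 * u2 * n ^ 2 * h)); [ring|].
    rewrite Hhk; ring. }
  assert (HW : W ^ 2 <= 600 * C ^ 2 * eps * Z + 3 * (C0 * M) ^ 2 * eps).
  { set (W1 := 4 * (h * (h * t)) * Q2r - 4 * (h * (h * r)) * Q2r).
    set (W2 := C0 * u2 * n ^ 2 * h).
    assert (HW1 : W1 ^ 2 <= 64 * (3 * C ^ 2 * eps * Z)).
    { assert (H1 : h ^ 2 * (h * t) ^ 2 * Q2r ^ 2 <= 3 * C ^ 2 * eps * Z) by now apply aux.
      assert (H2 : h ^ 2 * (h * r) ^ 2 * Q2r ^ 2 <= 3 * C ^ 2 * eps * Z) by now apply aux.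
      unfold W1. pose proof (pow2_ge_0 (4 * (h * (h * t)) * Q2r + 4 * (h * (h * r)) * Q2r)).
      clear - H H1 H2; nra. }
    assert (HW2 : W2 ^ 2 <= (C0 * M) ^ 2 * eps).
    { assert (Hu : Rabs (u2 * h) <= eps).
      { rewrite Rabs_mult, (Rabs_pos_eq h) by lra. clear - Hu2 hK Hh; nra. }
      apply sqr_le_of_Rabs_le in Hu.
      replace (W2 ^ 2) with ((C0 * n ^ 2) ^ 2 * (u2 * h) ^ 2) by (unfold W2; ring).
      apply Rmult_le_compat; try apply pow2_ge_0; [|lra].
      apply pow_incr. split; [apply Rmult_le_pos; [lra|apply pow2_ge_0]|].
      apply Rmult_le_compat_l; lra. }
    assert (HW3 : e2 ^ 2 <= 3 * C ^ 2 * eps * Z).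
    { apply sqr_le_of_Rabs_le in b5.
      replace ((C * h ^ 3 * L) ^ 2) with (h ^ 4 * h ^ 2 * (C * L) ^ 2) in b5 by ring.
      eapply Rle_trans; [exact b5|]. apply aux.
      - split; [apply pow_le; lra|]. replace (h ^ 4) with (h ^ 2 * h ^ 2) by ring. clear - h2; nra.
      - split; [lra|apply sq; lra].
      - split; [apply pow2_ge_0|lra]. }
    replace W with (W1 - W2 - e2) by (unfold W, W1, W2; ring).
    pose proof (pow2_ge_0 (W1 + W2)). pose proof (pow2_ge_0 (W2 - e2)).
    pose proof (pow2_ge_0 (W1 + e2)).
    clear - H H0 H1 HW1 HW2 HW3 C2Z Heps.
    assert (0 <= C ^ 2 * eps * Z).
    { replace (C ^ 2 * eps * Z) with ((3 * C ^ 2 * Z) * eps / 3) by field. nra. }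
    nra. }
  set (p := y * t * k).
  (* half of [Y ^ 2] beats [- 4 lam Q_2 ^ 2 / w ^ 2]; the other half absorbs errors *)
  assert (HY2 : 48 * p ^ 2 - 3 * W ^ 2 <= Y ^ 2).
  { rewrite HYW. replace (8 * y * t * k) with (8 * p) by (unfold p; ring).
    pose proof (pow2_ge_0 (4 * p + 2 * W)). clear - H; nra. }
  (* Young's inequality with 5 instead of the sharp 4. Half of [Y^2] supplies [24 p^2] and this term
     takes [4 * 5 p^2], so [4 p^2] is left over. *)
  assert (HQ2 : k ^ 2 * (2 * y + q) ^ 2 * t ^ 2 <= 5 * p ^ 2 + 5 * (k ^ 2 * q ^ 2 * t ^ 2)).
  { unfold p. pose proof (pow2_ge_0 (k * t * (y - 2 * q))). clear - H; nra. }
  (* Here the shape of [Q] matters: [y^2] equals [1/8 - w] up to [O(h^4)], so the leftover [4 p^2]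
     grows like [k^2 / (2 w^2)]. *)
  assert (Hp : k ^ 2 * (t ^ 2 / 2 - 4 * t) - M * eps <= 4 * p ^ 2).
  { assert (y2 : 1 / 8 - w - n ^ 2 * h ^ 4 / 4 <= y ^ 2).
    { assert (Hn4 : 0 <= n ^ 2 * h ^ 4) by (apply Rmult_le_pos; apply pow_le; lra).
      apply sqr_le_of_Rabs_le in Hx, Hy.
      assert (0 <= x ^ 2) by apply pow2_ge_0. assert (0 <= y ^ 2) by apply pow2_ge_0.
      assert (S * (x ^ 2 - y ^ 2) <= 1 / 4) by (clear - H H0 HS01 Hx Hy; nra).
      assert (n ^ 2 * h ^ 4 * S * (x ^ 2 - y ^ 2) <= n ^ 2 * h ^ 4 * (1 / 4)).
      { rewrite Rmult_assoc. now apply Rmult_le_compat_l. }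
      lra. }
    assert (T1 : 0 <= 4 * k ^ 2 * t ^ 2)
      by (nonneg).
    apply (Rmult_le_compat_l _ _ _ T1) in y2.
    replace (4 * p ^ 2) with (4 * k ^ 2 * t ^ 2 * y ^ 2) by (unfold p; ring).
    eapply Rle_trans; [|exact y2].
    replace (4 * k ^ 2 * t ^ 2 * (1 / 8 - w - n ^ 2 * h ^ 4 / 4))
      with (k ^ 2 * (t ^ 2 / 2 - 4 * (w * t) * t) - (h * k) ^ 2 * (n ^ 2 * (h * t) ^ 2)) by field.
    rewrite Ht, Hhk.
    assert (n ^ 2 * (h * t) ^ 2 <= M * eps).
    { apply Rmult_le_compat; apply pow2_ge_0 || lra. }
    lra. }
  (* Origin of 73: the losses in [k^2 t] are 8 from [L Q] and 4 from [Hp], and 72 completes the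
     square [(t - 12)^2 / 2]. The remaining [k^2] is kept for the gradient term. *)
  assert (Hmain : 0 <= k ^ 2 * (t ^ 2 / 2 - 12 * t + 72)).
  { apply Rmult_le_pos; [apply pow2_ge_0|]. pose proof (pow2_ge_0 (t - 12)). clear - H; nra. }
  assert (HC0n : 73 * k ^ 2 <= C0 * (n ^ 2 * (k ^ 2 + n ^ 2 * h ^ 2))).
  { assert (0 <= C0 * (n ^ 2 * (n ^ 2 * h ^ 2))).
    { nonneg. }
    assert (73 <= C0 * n ^ 2) by (clear - HC0m HC0 HnM; nra).
    assert (0 <= k ^ 2) by apply pow2_ge_0. clear - H H0 H1; nra. }
  assert (Huf : - (2 * K * A) <= u1 * f1 + u2 * f2).
  { assert (Rabs (u1 * f1) <= K * A).
    { rewrite Rabs_mult. apply Rmult_le_compat; auto using Rabs_pos. }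
    assert (Rabs (u2 * f2) <= K * A).
    { rewrite Rabs_mult. apply Rmult_le_compat; auto using Rabs_pos. }
    apply Rabs_le_between in H, H0. lra. }
  assert (HC0uf : - (2 * C0 * K * A) <= C0 * (u1 * f1 + u2 * f2)) by (clear - Huf HC0; nra).
  assert (Hsum' : X ^ 2 + Y ^ 2 + rhs - 8 * k ^ 2 * t - 4 * (rho * t)
     - 4 * (n ^ 2 * h ^ 2 * Q1 ^ 2 * t ^ 2) - 4 * (k ^ 2 * (2 * y + q) ^ 2 * t ^ 2)
     + 4 * (rho * r) - 8 * (n ^ 2 * h ^ 2 * r)
     - 4 * (n ^ 2 * h ^ 2 * (Q1 - 2 * x) ^ 2 * r ^ 2) - 4 * (k ^ 2 * q ^ 2 * r ^ 2)
     + C0 * (n ^ 2 * (k ^ 2 + n ^ 2 * h ^ 2)) + C0 * (u1 * f1 + u2 * f2) <= 0).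
  { eapply Rle_trans; [|exact Hsum]. right. unfold t, r. field. lra. }
  assert (HDZ : 27 * (C * eps * Z) + 36 * (M * C ^ 2 * eps * Z) + 1000 * (C ^ 2 * eps * Z)
                + 17 * (M * eps) + 5 * ((C0 * M) ^ 2 * eps) <= D * eps * Z).
  { unfold D. assert (0 < M * eps) by (apply Rmult_lt_0_compat; lra).
    assert (M * eps <= M * eps * Z) by (clear - H HZ; nra).
    assert (0 <= (C0 * M) ^ 2 * eps) by (apply Rmult_le_pos; [apply pow2_ge_0|lra]).
    assert ((C0 * M) ^ 2 * eps <= (C0 * M) ^ 2 * eps * Z) by (clear - H1 HZ; nra).
    assert (0 <= eps * Z) by (apply Rmult_le_pos; lra). lra. }
  assert (HDe : D * eps * Z <= 1 / 2 * Z).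
  { apply Rmult_le_compat_r; [lra|]. unfold E in HepsE.
    assert (0 <= C0 * A) by (apply Rmult_le_pos; lra). clear - H HepsE Heps; nra. }
  assert (Hk2 : 1 + 2 * C0 * K * A < k ^ 2).
  { assert (k1 : 1 + K <= eps * k).
    { replace (1 + K) with (h * (1 + K) * k) by
        (replace (h * (1 + K) * k) with ((h * k) * (1 + K)) by ring; rewrite Hhk; ring).
      apply Rmult_le_compat_r; lra. }
    assert (k2 : E * (1 + K) <= k).
    { replace k with (E * (eps * k)) by
        (replace (E * (eps * k)) with (eps * E * k) by ring; rewrite HepsE; ring).
      apply Rmult_le_compat_l; lra. }
    assert (k3 : 1 + 2 * C0 * K * A < k).
    { assert (0 <= C0 * A) by (apply Rmult_le_pos; lra). unfold E in k2.
      clear - H k2 HD HK; nra. }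
    assert (0 <= C0 * K * A) by (nonneg).
    clear - H k3; nra. }
  assert (0 <= C ^ 2 * eps * Z)
    by (nonneg).
  assert (0 <= C * eps * Z) by (nonneg).
  assert (0 <= (C0 * M) ^ 2 * eps) by (apply Rmult_le_pos; [apply pow2_ge_0|lra]).
  assert (0 <= M * eps) by (apply Rmult_le_pos; lra).
  assert (HZdef : X ^ 2 + Y ^ 2 = Z - 1) by (unfold Z; ring).
  assert (0 <= X ^ 2) by apply pow2_ge_0.
  lra.
Qed.

(** * Reduction of a maximum point to the normal form *)

(** [a], ..., [d] and [e0], ..., [e4] are the third and fourth derivatives of [u], ordered by the
    number of differentiations in [y], where [D^2u = diag(lam, mu)]. The equations are the
    differentiated Monge-Ampère equation and Leibniz identities for the product of [Q] and the
    trace. If the bound failed, [h = lam^(-1/2)] would be small against [w v], as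
    [reduced_contradiction] requires. *)
Lemma maximum_point_bound (m M A B : R) :
  0 < m -> m <= M -> 0 <= A -> 0 <= B ->
  exists eps : R, 0 < eps /\
  forall lam mu a b c d e0 e1 e2 e3 e4 x y f1 f2 f11 f12 f22 u1 u2 K
    Q Q1 Q2 Q11 Q22 w v : R,
  0 < mu -> 0 < lam -> m <= lam * mu <= M ->
  Rabs x <= 1 / 2 -> Rabs y <= 1 / 2 ->
  Rabs f1 <= A -> Rabs f2 <= A ->
  Rabs f11 <= B -> Rabs f12 <= B -> Rabs f22 <= B ->
  Rabs u1 <= K -> Rabs u2 <= K ->
  mu * a + lam * c = f1 -> mu * b + lam * d = f2 ->
  mu * e0 + lam * e2 + 2 * (a * c - b ^ 2) = f11 ->
  mu * e1 + lam * e3 + a * d - b * c = f12 ->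
  mu * e2 + lam * e4 + 2 * (b * d - c ^ 2) = f22 ->
  Q * (lam + mu) = mu * x ^ 2 + lam * y ^ 2 ->
  Q1 * (lam + mu) + Q * (a + c)
    = c * x ^ 2 - 2 * b * x * y + a * y ^ 2 + 2 * mu * x ->
  Q2 * (lam + mu) + Q * (b + d)
    = d * x ^ 2 - 2 * c * x * y + b * y ^ 2 + 2 * lam * y ->
  Q11 * (lam + mu) + 2 * Q1 * (a + c) + Q * (e0 + e2)
    = e2 * x ^ 2 + 4 * c * x + 2 * mu - 2 * e1 * x * y - 4 * b * y + e0 * y ^ 2 ->
  Q22 * (lam + mu) + 2 * Q2 * (b + d) + Q * (e2 + e4)
    = e4 * x ^ 2 - 2 * e3 * x * y - 4 * c * x + e2 * y ^ 2 + 4 * b * y + 2 * lam ->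
  w = 1 / 8 - Q -> v = 1 / 8 - (x ^ 2 + y ^ 2 - Q) -> 0 < w -> 0 < v ->
  (b + d) / (lam + mu) - 4 * (Q2 / w) + 4 * ((Q2 - 2 * y) / v)
    + 73 / m * (u2 * mu) = 0 ->
  (e0 + e2) / (lam + mu) - ((a + c) / (lam + mu)) ^ 2
    - 4 * (Q11 / w + (Q1 / w) ^ 2)
    + 4 * ((Q11 - 2) / v - ((Q1 - 2 * x) / v) ^ 2)
    + 73 / m * (lam ^ 2 + u1 * a + u2 * b) <= 0 ->
  (e2 + e4) / (lam + mu) - ((b + d) / (lam + mu)) ^ 2
    - 4 * (Q22 / w + (Q2 / w) ^ 2)
    + 4 * ((Q22 - 2) / v - ((Q2 - 2 * y) / v) ^ 2)
    + 73 / m * (mu ^ 2 + u1 * c + u2 * d) <= 0 ->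
  eps * (lam * (w * v) ^ 2) <= (1 + K) ^ 2.
Proof.
  intros Hm HmM HA HB.
  destruct (reduced_contradiction m M A B Hm HmM HA HB) as (eps & Heps & contra).
  exists (eps ^ 2). split; [nra|].
  intros lam mu a b c d e0 e1 e2 e3 e4 x y f1 f2 f11 f12 f22 u1 u2 K
    Q Q1 Q2 Q11 Q22 w v Hmu Hlam Hf Hx Hy Hf1 Hf2 Hf11 Hf12 Hf22 Hu1 Hu2
    E1 E2 E11 E12 E22 HQ HQ1 HQ2 HQ11 HQ22 Hw Hv Hw0 Hv0 C2 S11 S22.
  apply Rnot_lt_le. intros Hbig.
  assert (HK : 0 <= K) by (pose proof (Rabs_pos u1); lra).
  set (C0 := 73 / m) in *.
  set (k := sqrt lam). set (n := sqrt (lam * mu)).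
  assert (Hk : 0 < k) by now apply sqrt_lt_R0.
  assert (Hn : 0 < n) by (apply sqrt_lt_R0; lra).
  assert (Hk2 : lam = k ^ 2) by (unfold k; rewrite pow2_sqrt; lra).
  assert (Hn2 : lam * mu = n ^ 2) by (unfold n; rewrite pow2_sqrt; lra).
  clearbody k n.
  assert (Hmu2 : mu = n ^ 2 / k ^ 2) by (rewrite <- Hn2, Hk2; field; lra).
  set (X := n * a / k ^ 3). set (Y := b / k).
  assert (Ha : a = k ^ 3 * X / n) by (unfold X; field; lra).
  assert (Hb : b = k * Y) by (unfold Y; field; lra).
  clearbody X Y.
  assert (Hc : c = (f1 - mu * a) / lam) by (rewrite <- E1; field; lra).
  assert (Hd : d = (f2 - mu * b) / lam) by (rewrite <- E2; field; lra).
  set (s := lam + mu) in *.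
  assert (Hs : 0 < s) by (unfold s; lra).
  assert (EQ : Q = (mu * x ^ 2 + lam * y ^ 2) / s) by (rewrite <- HQ; field; lra).
  assert (EQ1 : Q1 = (c * x ^ 2 - 2 * b * x * y + a * y ^ 2 + 2 * mu * x - Q * (a + c)) / s)
    by (rewrite <- HQ1; field; lra).
  assert (EQ2 : Q2 = (d * x ^ 2 - 2 * c * x * y + b * y ^ 2 + 2 * lam * y - Q * (b + d)) / s)
    by (rewrite <- HQ2; field; lra).
  set (h := / k). set (ni := / n). set (S := / (1 + n ^ 2 * h ^ 4)).
  assert (Hh : 0 < h) by now apply Rinv_0_lt_compat.
  assert (Hden : 1 + n ^ 2 * h ^ 4 <> 0).
  { assert (0 < h ^ 4) by now apply pow_lt. assert (0 <= n ^ 2) by apply pow2_ge_0.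
    clear - H H0. nra. }
  assert (Hhk : h * k = 1) by (unfold h; field; lra).
  assert (Hkh : k = / h) by (unfold h; field; lra).
  assert (HS : S * (1 + n ^ 2 * h ^ 4) = 1) by (unfold S; field; exact Hden).
  assert (Hs' : s = k ^ 2 + n ^ 2 / k ^ 2) by (unfold s; rewrite Hmu2, Hk2; ring).
  assert (Hi : / s = h ^ 2 * S).
  { unfold S, h in *. rewrite Hs'. clear - Hk Hn. field.
    assert (0 < k ^ 4) by now apply pow_lt. assert (0 < n ^ 2) by now apply pow_lt.
    repeat split; try lra. }
  assert (Hmuh : mu = n ^ 2 * h ^ 2) by (rewrite Hmu2; unfold h; field; lra).
  assert (Hch : c = h * c_red h n X f1).
  { rewrite Hc, Hmu2, Ha, Hk2. unfold c_red, h. field. lra. }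
  assert (Hdh : d = f2 * h ^ 2 - n ^ 2 * h ^ 3 * Y).
  { rewrite Hd, Hmu2, Hb, Hk2. unfold h. field. lra. }
  assert (Han : a = k ^ 3 * X * ni) by (rewrite Ha; unfold ni; field; lra).
  assert (HQ1r : Q1 = h * Q1_red h n S X Y x y f1).
  { transitivity ((f1 - 2 * mu * a) * (x ^ 2 - y ^ 2) * (/ s) ^ 2
      - 2 * b * x * y * / s + 2 * mu * x * / s).
    { rewrite EQ1, EQ, <- E1. unfold s. field. lra. }
    rewrite Hi, Hmuh, Ha, Hb, Hkh. unfold Q1_red. field. lra. }
  assert (HQ2r : Q2 = 2 * y + h ^ 3 * Q2_red h n S X Y x y f1 f2).
  { transitivity ((f2 - 2 * mu * b) * (x ^ 2 - y ^ 2) * (/ s) ^ 2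
      - 2 * c * x * y * / s + 2 * y - 2 * mu * y * / s).
    { rewrite EQ2, EQ, <- E2. unfold s. field. lra. }
    rewrite Hi, Hmuh, Hch, Hb, Hkh. unfold Q2_red, c_red. field. lra. }
  assert (LQ : mu * Q11 + lam * Q22
     = 2 * k ^ 2 + LQ_err h n ni S X Y x y f1 f2 f11 f12 f22).
  (* The fourth derivatives enter [L Q] only through the three combinations [mu e_i + lam e_(i+2)],
     which the twice differentiated equation expresses by third derivatives and [D^2f]. *)
  { transitivity (/ s *
      ((x ^ 2 - y ^ 2) * / s * (lam * f22 - mu * f11 + 2 * c * f1 - 2 * b * f2)
       - 2 * x * y * (f12 + (b * f1 - a * f2) / lam)
       + 4 * (lam - mu) * (b * y - c * x)
       - 2 * (mu * Q1 * (a + c) + lam * Q2 * (b + d)))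
      + 2 * (lam ^ 2 + mu ^ 2) * / s).
    { apply Rmult_eq_reg_r with s; [|lra].
      transitivity
       (x ^ 2 * (f22 - 2 * (b * d - c ^ 2)) - 2 * x * y * (f12 - a * d + b * c)
        + y ^ 2 * (f11 - 2 * (a * c - b ^ 2)) + 4 * c * x * (mu - lam)
        + 4 * b * y * (lam - mu) + 2 * mu ^ 2 + 2 * lam ^ 2
        - 2 * (mu * Q1 * (a + c) + lam * Q2 * (b + d))
        - Q * (f11 - 2 * (a * c - b ^ 2) + (f22 - 2 * (b * d - c ^ 2)))).
      { rewrite <- E11, <- E22, <- E12.
        transitivity (mu * (Q11 * s) + lam * (Q22 * s)); [ring|].
        replace (Q11 * s) with (Q11 * s + 2 * Q1 * (a + c) + Q * (e0 + e2)
          - 2 * Q1 * (a + c) - Q * (e0 + e2)) by ring.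
        replace (Q22 * s) with (Q22 * s + 2 * Q2 * (b + d) + Q * (e2 + e4)
          - 2 * Q2 * (b + d) - Q * (e2 + e4)) by ring.
        rewrite HQ11, HQ22. ring. }
      rewrite EQ, <- E1, <- E2. clear - Hlam Hmu Hs. unfold s. field. lra. }
    assert (T3 : 2 * (lam ^ 2 + mu ^ 2) * / s
      = 2 * k ^ 2 + (2 * n ^ 2 * h ^ 2 - 4 * n ^ 2 * h ^ 2 * S)).
    { transitivity (2 * lam + 2 * mu - 4 * (lam * mu) * / s).
      { unfold s; field. lra. }
      rewrite Hi, Hn2, Hk2, Hmuh. ring. }
    rewrite T3, Hi, HQ1r, HQ2r, Hch, Hdh, Han, Hb, Hk2, Hmuh.
    unfold LQ_err. rewrite Hkh. generalize (Q1_red h n S X Y x y f1)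
      (Q2_red h n S X Y x y f1 f2). intros q1 q2.
    unfold c_red, s1_err, s2_err.
    clear - Hh. field. lra. }
  assert (Ls : mu * ((e0 + e2) / s - ((a + c) / s) ^ 2)
      + lam * ((e2 + e4) / s - ((b + d) / s) ^ 2)
      = X ^ 2 + Y ^ 2 + Llogs_err h n ni S X Y f1 f2 f11 f22).
  { transitivity ((f11 + f22 + 2 * (b ^ 2 + c ^ 2 - a * c - b * d)) * / s
      - mu * ((a + c) * / s) ^ 2 - lam * ((b + d) * / s) ^ 2).
    { rewrite <- E11, <- E22. field. lra. }
    assert (HS1 : 1 - S = n ^ 2 * h ^ 4 * S) by lra.
    unfold Llogs_err. rewrite <- HS1.
    rewrite Hi, Hch, Hdh, Han, Hb, Hk2, Hmuh, Hkh.
    unfold c_red, s1_err, s2_err, ni. clear - Hh Hn. field. lra. }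
  apply (contra h n ni S X Y x y f1 f2 f11 f12 f22 u1 u2 w v K k);
    try assumption.
  - unfold ni; field; lra.
  - rewrite <- Hn2; lra.
  - split; [assumption|]. pose proof (pow2_ge_0 x). pose proof (pow2_ge_0 y). lra.
  - split; [assumption|]. pose proof (pow2_ge_0 x). pose proof (pow2_ge_0 y). lra.
  - rewrite Hw, EQ. unfold Rdiv at 2. rewrite Hi, Hk2, Hmuh.
    replace (y ^ 2) with (y ^ 2 * (S * (1 + n ^ 2 * h ^ 4))) at 2 by (rewrite HS; ring).
    rewrite Hkh. clear - Hh. field. lra.
  - assert (0 < w * v) by now apply Rmult_lt_0_compat.
    assert (1 + K < eps * k * (w * v)).
    { apply Rnot_le_lt. intros Hle.
      apply Rlt_not_le in Hbig. apply Hbig.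
      replace (eps ^ 2 * (lam * (w * v) ^ 2)) with ((eps * k * (w * v)) ^ 2)
        by (rewrite Hk2; ring).
      apply pow_incr. split; [|exact Hle]. repeat apply Rmult_le_pos; lra. }
    apply Rmult_le_reg_l with k; [lra|].
    replace (k * (h * (1 + K))) with ((h * k) * (1 + K)) by ring.
    rewrite Hhk. lra.
  - rewrite <- HQ2r. fold C0. rewrite <- Hmuh.
    assert (Hs2 : (b + d) / s = h * Y + h * logs2_err h n S Y f2).
    { unfold Rdiv. rewrite Hi, Hdh, Hb, Hkh. unfold logs2_err, s2_err.
      replace (h * Y) with (h * Y * (S * (1 + n ^ 2 * h ^ 4))) by (rewrite HS; ring).
      clear - Hh. field. lra. }
    rewrite <- Hs2.
    replace (h ^ 3 * Q2_red h n S X Y x y f1 f2) with (Q2 - 2 * y) by (rewrite HQ2r; ring).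
    unfold Rdiv in *. lra.
  - rewrite <- HQ2r, <- HQ1r. fold C0. rewrite <- Hmuh, <- Hk2, <- Hn2, <- Ls.
    replace (h ^ 3 * Q2_red h n S X Y x y f1 f2) with (Q2 - 2 * y) by (rewrite HQ2r; ring).
    assert (LQ' : LQ_err h n ni S X Y x y f1 f2 f11 f12 f22
      = mu * Q11 + lam * Q22 - 2 * lam) by (rewrite LQ, Hk2; ring).
    rewrite LQ'.
    apply (Rmult_le_compat_l mu) in S11; [|lra].
    apply (Rmult_le_compat_l lam) in S22; [|lra].
    rewrite Rmult_0_r in S11, S22.
    apply Rle_trans with (0 + 0); [|lra].
    eapply Rle_trans; [|apply (Rplus_le_compat _ _ _ _ S11 S22)].
    right. rewrite <- E1, <- E2. clear - Hs Hw0 Hv0. unfold s in *. field. lra.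
Qed.

(** * Calculus on discs *)

Lemma Rabs_lt_of_sqr_lt (e b : R) : 0 < b -> e ^ 2 < b ^ 2 -> Rabs e < b.
Proof.
  intros Hb H. apply Rnot_le_lt. intros Hle.
  apply (Rlt_not_le _ _ H). rewrite <- (pow2_abs e). apply pow_incr. lra.
Qed.

Lemma ball0_open (r x y : R) : ball0 r x y -> locally_2d (ball0 r) x y.
Proof.
  intros H.
  assert (C : continuity_2d_pt (fun x y => x * x + y * y) x y).
  { apply continuity_2d_pt_plus; apply continuity_2d_pt_mult;
      apply continuity_2d_pt_id1 || apply continuity_2d_pt_id2. }
  unfold ball0 in *.
  destruct (C (mkposreal _ (proj2 (Rlt_0_minus _ _) H))) as [d Hd].
  exists d. intros u v Hu Hv. specialize (Hd u v Hu Hv); simpl in Hd.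
  apply Rabs_lt_between in Hd. lra.
Qed.

Lemma cont_on_ball0 (r : R) (g : R -> R -> R) :
  cont_on (ball0 r) g <-> (forall x y, ball0 r x y -> continuity_2d_pt g x y).
Proof.
  split.
  - intros H x y Hxy eps.
    destruct (H x y Hxy eps (cond_pos eps)) as (d & Hd & Hg).
    destruct (ball0_open r x y Hxy) as [d' Hd'].
    assert (Hm : 0 < Rmin (d / 2) d') by (apply Rmin_pos; [lra|apply cond_pos]).
    exists (mkposreal _ Hm). simpl. intros u v Hu Hv.
    pose proof (Rmin_l (d / 2) d'). pose proof (Rmin_r (d / 2) d').
    apply Hg; [apply Hd'; lra|].
    apply Rabs_def2 in Hu, Hv. nra.
  - intros H x y Hxy eps Heps.
    destruct (H x y Hxy (mkposreal _ Heps)) as [d Hd].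
    exists d. split; [apply cond_pos|]. intros u v _ Huv.
    pose proof (pow2_ge_0 (u - x)). pose proof (pow2_ge_0 (v - y)).
    pose proof (cond_pos d).
    apply Hd; apply Rabs_lt_of_sqr_lt; lra.
Qed.

Lemma ball0_locally_x (r x y : R) : ball0 r x y -> locally x (fun t => ball0 r t y).
Proof. intros H. now apply (locally_2d_1d_const_y (ball0 r)), ball0_open. Qed.

Lemma ball0_locally_y (r x y : R) : ball0 r x y -> locally y (fun t => ball0 r x t).
Proof. intros H. now apply (locally_2d_1d_const_x (ball0 r)), ball0_open. Qed.

Lemma dx_on_ext (r : R) (g g' h h' : R -> R -> R) :
  (forall x y, ball0 r x y -> g x y = g' x y) ->
  (forall x y, ball0 r x y -> h x y = h' x y) ->
  dx_on (ball0 r) g h -> dx_on (ball0 r) g' h'.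
Proof.
  intros Eg Eh H x y Hxy. apply is_derive_Reals. rewrite <- (Eh x y Hxy).
  apply is_derive_ext_loc with (fun t => g t y); [|now apply is_derive_Reals, H].
  apply filter_imp with (2 := ball0_locally_x _ _ _ Hxy). auto.
Qed.

Lemma dy_on_ext (r : R) (g g' h h' : R -> R -> R) :
  (forall x y, ball0 r x y -> g x y = g' x y) ->
  (forall x y, ball0 r x y -> h x y = h' x y) ->
  dy_on (ball0 r) g h -> dy_on (ball0 r) g' h'.
Proof.
  intros Eg Eh H x y Hxy. apply is_derive_Reals. rewrite <- (Eh x y Hxy).
  apply is_derive_ext_loc with (fun t => g x t); [|now apply is_derive_Reals, H].
  apply filter_imp with (2 := ball0_locally_y _ _ _ Hxy). auto.
Qed.

Lemma dx_on_unique (U : R -> R -> Prop) (g h h' : R -> R -> R) :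
  dx_on U g h -> dx_on U g h' -> forall x y, U x y -> h x y = h' x y.
Proof. intros H H' x y Hxy. eapply uniqueness_limite; [apply H|apply H']; auto. Qed.

Lemma dy_on_unique (U : R -> R -> Prop) (g h h' : R -> R -> R) :
  dy_on U g h -> dy_on U g h' -> forall x y, U x y -> h x y = h' x y.
Proof. intros H H' x y Hxy. eapply uniqueness_limite; [apply H|apply H']; auto. Qed.

Lemma Ck_ext (r : R) (k : nat) (g g' : R -> R -> R) :
  (forall x y, ball0 r x y -> g x y = g' x y) ->
  Ck k (ball0 r) g -> Ck k (ball0 r) g'.
Proof.
  intros E.
  assert (C : cont_on (ball0 r) g -> cont_on (ball0 r) g').
  { intros H x y Hxy eps Heps. destruct (H x y Hxy eps Heps) as (d & Hd & H').
    exists d. split; [exact Hd|]. intros. rewrite <- !E by assumption. auto. }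
  destruct k as [|k]; [exact C|].
  intros (Hc & gx & gy & Hx & Hy & H). split; [auto|].
  exists gx, gy. split; [|split; [|exact H]].
  - eapply dx_on_ext; [exact E|reflexivity|exact Hx].
  - eapply dy_on_ext; [exact E|reflexivity|exact Hy].
Qed.

Lemma Ck_cont (k : nat) (U : R -> R -> Prop) (g : R -> R -> R) :
  Ck k U g -> cont_on U g.
Proof. destruct k; [auto|intros [H _]; exact H]. Qed.

(** [Ck] only speaks of some derivative; uniqueness on the open disc transfers its regularity to the
    given one. *)
Lemma Ck_dx (r : R) (k : nat) (g h : R -> R -> R) :
  Ck (S k) (ball0 r) g -> dx_on (ball0 r) g h -> Ck k (ball0 r) h.
Proof.
  intros (_ & gx & gy & Hx & Hy & Kx & Ky) Hh.
  apply Ck_ext with gx; [|exact Kx]. eapply dx_on_unique; eassumption.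
Qed.

Lemma Ck_dy (r : R) (k : nat) (g h : R -> R -> R) :
  Ck (S k) (ball0 r) g -> dy_on (ball0 r) g h -> Ck k (ball0 r) h.
Proof.
  intros (_ & gx & gy & Hx & Hy & Kx & Ky) Hh.
  apply Ck_ext with gy; [|exact Ky]. eapply dy_on_unique; eassumption.
Qed.

Lemma Ck_pred (U : R -> R -> Prop) (k : nat) (g : R -> R -> R) :
  Ck (S k) U g -> Ck k U g.
Proof.
  revert g. induction k as [|k IH]; intros g H; [apply H|].
  destruct H as (Hc & gx & gy & Hx & Hy & Kx & Ky).
  split; [exact Hc|]. exists gx, gy. auto.
Qed.

(** Continuity of one partial derivative is enough: the increment in [x] is controlled by the mean
    value theorem, the one in [y] by the derivative at the point itself. *)
Lemma differentiable_on_ball0 (r : R) (g gx gy : R -> R -> R) :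
  dx_on (ball0 r) g gx -> dy_on (ball0 r) g gy -> cont_on (ball0 r) gx ->
  forall x y, ball0 r x y -> differentiable_pt_lim g x y (gx x y) (gy x y).
Proof.
  intros Hx Hy Hc x y Hxy.
  apply filterdiff_differentiable_pt_lim.
  apply (is_derive_filterdiff g x y gx (gy x y)).
  - apply (locally_2d_locally (fun u v => is_derive (fun z => g z v) u (gx u v))).
    destruct (ball0_open r x y Hxy) as [d Hd]. exists d. intros u v Hu Hv.
    now apply is_derive_Reals, Hx, Hd.
  - now apply is_derive_Reals, Hy.
  - apply continuity_2d_pt_filterlim. now apply (proj1 (cont_on_ball0 r gx)).
Qed.

Lemma mixed_partials_eq (r : R) (g gx gy gxy gyx : R -> R -> R) :
  dx_on (ball0 r) g gx -> dy_on (ball0 r) g gy ->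
  dy_on (ball0 r) gx gxy -> dx_on (ball0 r) gy gyx ->
  cont_on (ball0 r) gxy -> cont_on (ball0 r) gyx ->
  forall x y, ball0 r x y -> gyx x y = gxy x y.
Proof.
  intros Hx Hy Hxy Hyx Cxy Cyx x y H.
  assert (Ex : forall u v, ball0 r u v -> Derive (fun t => g t v) u = gx u v).
  { intros u v Huv. now apply is_derive_unique, is_derive_Reals, Hx. }
  assert (Ey : forall u v, ball0 r u v -> Derive (fun t => g u t) v = gy u v).
  { intros u v Huv. now apply is_derive_unique, is_derive_Reals, Hy. }
  assert (Dxy : forall u v, ball0 r u v ->
    is_derive (fun z => Derive (fun t => g t z) u) v (gxy u v)).
  { intros u v Huv. apply is_derive_ext_loc with (fun z => gx u z);
      [|now apply is_derive_Reals, Hxy].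
    apply filter_imp with (2 := ball0_locally_y _ _ _ Huv).
    intros z Hz. now rewrite Ex. }
  assert (Dyx : forall u v, ball0 r u v ->
    is_derive (fun z => Derive (fun t => g z t) v) u (gyx u v)).
  { intros u v Huv. apply is_derive_ext_loc with (fun z => gy z v);
      [|now apply is_derive_Reals, Hyx].
    apply filter_imp with (2 := ball0_locally_x _ _ _ Huv).
    intros z Hz. now rewrite Ey. }
  rewrite <- (is_derive_unique _ _ _ (Dxy x y H)).
  rewrite <- (is_derive_unique _ _ _ (Dyx x y H)).
  destruct (ball0_open r x y H) as [d Hd].
  apply Schwarz.
  - exists d. intros u v Hu Hv. specialize (Hd u v Hu Hv). repeat split; eexists.
    + now apply is_derive_Reals, Hx.
    + now apply is_derive_Reals, Hy.
    + now apply Dyx.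
    + now apply Dxy.
  - apply continuity_2d_pt_ext_loc with gyx; [|now apply (cont_on_ball0 r)].
    exists d. intros u v Hu Hv. symmetry. now apply is_derive_unique, Dyx, Hd.
  - apply continuity_2d_pt_ext_loc with gxy; [|now apply (cont_on_ball0 r)].
    exists d. intros u v Hu Hv. symmetry. now apply is_derive_unique, Dxy, Hd.
Qed.

(** * Second order jets and plane similarities *)

(** A single [g12] serves as both mixed derivatives, so that their equality is part of the data. *)
Record jet2 (U : R -> R -> Prop) (g g1 g2 g11 g12 g22 : R -> R -> R) : Prop := {
  jet_1 : dx_on U g g1;
  jet_2 : dy_on U g g2;
  jet_11 : dx_on U g1 g11;
  jet_12 : dy_on U g1 g12;
  jet_21 : dx_on U g2 g12;
  jet_22 : dy_on U g2 g22 }.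

Lemma jet2_intro (r : R) (g g1 g2 g11 g12 g22 : R -> R -> R) :
  Ck 2 (ball0 r) g ->
  dx_on (ball0 r) g g1 -> dy_on (ball0 r) g g2 ->
  dx_on (ball0 r) g1 g11 -> dy_on (ball0 r) g1 g12 -> dy_on (ball0 r) g2 g22 ->
  jet2 (ball0 r) g g1 g2 g11 g12 g22.
Proof.
  intros HC H1 H2 H11 H12 H22. split; try assumption.
  pose proof (Ck_dy _ _ _ _ HC H2) as C2. pose proof (Ck_dx _ _ _ _ HC H1) as C1.
  destruct C2 as (_ & g21 & g22' & H21 & _ & C21 & _).
  eapply dx_on_ext; [reflexivity| |exact H21].
  apply (mixed_partials_eq r g g1 g2 g12 g21); try assumption.
  exact (Ck_dy _ 0 _ _ C1 H12).
Qed.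

Lemma jet2_exists (r : R) (g : R -> R -> R) :
  Ck 2 (ball0 r) g ->
  exists g1 g2 g11 g12 g22, jet2 (ball0 r) g g1 g2 g11 g12 g22.
Proof.
  intros HC. pose proof HC as HC'.
  destruct HC' as (_ & g1 & g2 & H1 & H2 & (_ & g11 & g12 & H11 & H12 & _) &
    (_ & g21 & g22 & _ & H22 & _)).
  exists g1, g2, g11, g12, g22. now apply jet2_intro.
Qed.

(** The argument is the complex product [(p + i q) (x + i y)]. One definition thus covers the
    dilation to the unit disc ([p = r], [q = 0]) and the rotation to the eigenframe
    ([p^2 + q^2 = 1]). *)
Definition sim (k p q : R) (g : R -> R -> R) (x y : R) : R :=
  k * g (p * x - q * y) (q * x + p * y).

Lemma sim_ball0 (r p q x y : R) :
  0 < r -> p ^ 2 + q ^ 2 = r ^ 2 ->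
  ball0 1 x y -> ball0 r (p * x - q * y) (q * x + p * y).
Proof.
  unfold ball0. intros Hr H Hxy.
  replace ((p * x - q * y) * (p * x - q * y) + (q * x + p * y) * (q * x + p * y))
    with ((p ^ 2 + q ^ 2) * (x * x + y * y)) by ring.
  rewrite H. assert (0 < r ^ 2) by now apply pow_lt. nra.
Qed.

Section Sim.
Variables (r k p q : R).
Hypothesis Hr : 0 < r.
Hypothesis Hpq : p ^ 2 + q ^ 2 = r ^ 2.

Lemma sim_dx (g g1 g2 : R -> R -> R) :
  dx_on (ball0 r) g g1 -> dy_on (ball0 r) g g2 -> cont_on (ball0 r) g1 ->
  dx_on (ball0 1) (sim k p q g) (fun x y => p * sim k p q g1 x y + q * sim k p q g2 x y).
Proof.
  intros H1 H2 HC x y Hxy.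
  pose proof (differentiable_on_ball0 r g g1 g2 H1 H2 HC _ _
    (sim_ball0 r p q x y Hr Hpq Hxy)) as D.
  assert (D1 : derivable_pt_lim (fun t => p * t - q * y) x p).
  { apply is_derive_Reals. auto_derive; [exact I|ring]. }
  assert (D2 : derivable_pt_lim (fun t => q * t + p * y) x q).
  { apply is_derive_Reals. auto_derive; [exact I|ring]. }
  pose proof (derivable_pt_lim_comp_2d g (fun t => p * t - q * y)
    (fun t => q * t + p * y) x _ _ _ _ D D1 D2) as D3.
  apply (derivable_pt_lim_scal _ k) in D3.
  unfold sim.
  match type of D3 with derivable_pt_lim _ _ ?l =>
    replace (p * _ + q * _) with l by ring end.
  exact D3.
Qed.

Lemma sim_dy (g g1 g2 : R -> R -> R) :
  dx_on (ball0 r) g g1 -> dy_on (ball0 r) g g2 -> cont_on (ball0 r) g1 ->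
  dy_on (ball0 1) (sim k p q g) (fun x y => - q * sim k p q g1 x y + p * sim k p q g2 x y).
Proof.
  intros H1 H2 HC x y Hxy.
  pose proof (differentiable_on_ball0 r g g1 g2 H1 H2 HC _ _
    (sim_ball0 r p q x y Hr Hpq Hxy)) as D.
  assert (D1 : derivable_pt_lim (fun t => p * x - q * t) y (- q)).
  { apply is_derive_Reals. auto_derive; [exact I|ring]. }
  assert (D2 : derivable_pt_lim (fun t => q * x + p * t) y p).
  { apply is_derive_Reals. auto_derive; [exact I|ring]. }
  pose proof (derivable_pt_lim_comp_2d g (fun t => p * x - q * t)
    (fun t => q * x + p * t) y _ _ _ _ D D1 D2) as D3.
  apply (derivable_pt_lim_scal _ k) in D3.
  unfold sim.
  match type of D3 with derivable_pt_lim _ _ ?l =>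
    replace (- q * _ + p * _) with l by ring end.
  exact D3.
Qed.

Lemma sim_cont (g : R -> R -> R) : cont_on (ball0 r) g -> cont_on (ball0 1) (sim k p q g).
Proof.
  rewrite !cont_on_ball0. intros H x y Hxy.
  apply continuity_2d_pt_mult; [apply continuity_2d_pt_const|].
  pose proof (H _ _ (sim_ball0 r p q x y Hr Hpq Hxy)) as HC.
  intros eps. destruct (HC eps) as [d Hd].
  assert (L1 : continuity_2d_pt (fun x y => p * x - q * y) x y).
  { apply continuity_2d_pt_minus; apply continuity_2d_pt_mult;
     apply continuity_2d_pt_const || apply continuity_2d_pt_id1 || apply continuity_2d_pt_id2. }
  assert (L2 : continuity_2d_pt (fun x y => q * x + p * y) x y).
  { apply continuity_2d_pt_plus; apply continuity_2d_pt_mult;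
     apply continuity_2d_pt_const || apply continuity_2d_pt_id1 || apply continuity_2d_pt_id2. }
  apply locally_2d_impl with (2 := locally_2d_and _ _ _ _ (L1 d) (L2 d)).
  apply locally_2d_forall. intros u v [Hu Hv]. now apply Hd.
Qed.

End Sim.

Lemma dx_on_lin (U : R -> R -> Prop) (a b : R) (g h g' h' : R -> R -> R) :
  dx_on U g g' -> dx_on U h h' ->
  dx_on U (fun x y => a * g x y + b * h x y) (fun x y => a * g' x y + b * h' x y).
Proof.
  intros Hg Hh x y Hxy.
  apply (derivable_pt_lim_plus (fun t => a * g t y) (fun t => b * h t y)).
  - apply (derivable_pt_lim_scal (fun t => g t y)). now apply Hg.
  - apply (derivable_pt_lim_scal (fun t => h t y)). now apply Hh.
Qed.

Lemma dy_on_lin (U : R -> R -> Prop) (a b : R) (g h g' h' : R -> R -> R) :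
  dy_on U g g' -> dy_on U h h' ->
  dy_on U (fun x y => a * g x y + b * h x y) (fun x y => a * g' x y + b * h' x y).
Proof.
  intros Hg Hh x y Hxy.
  apply (derivable_pt_lim_plus (fun t => a * g x t) (fun t => b * h x t)).
  - apply (derivable_pt_lim_scal (fun t => g x t)). now apply Hg.
  - apply (derivable_pt_lim_scal (fun t => h x t)). now apply Hh.
Qed.

Lemma Ck_lin (r : R) (k : nat) (a b : R) (g h : R -> R -> R) :
  Ck k (ball0 r) g -> Ck k (ball0 r) h ->
  Ck k (ball0 r) (fun x y => a * g x y + b * h x y).
Proof.
  assert (CC : forall g h, cont_on (ball0 r) g -> cont_on (ball0 r) h ->
    cont_on (ball0 r) (fun x y => a * g x y + b * h x y)).
  { intros g0 h0. rewrite !cont_on_ball0. intros Hg Hh x y Hxy.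
    apply continuity_2d_pt_plus; apply continuity_2d_pt_mult;
      auto; apply continuity_2d_pt_const. }
  revert g h. induction k as [|k IH]; intros g h Hg Hh; [now apply CC|].
  split; [apply CC; now apply (Ck_cont (S k))|].
  destruct Hg as (_ & gx & gy & Hgx & Hgy & Kgx & Kgy).
  destruct Hh as (_ & hx & hy & Hhx & Hhy & Khx & Khy).
  exists (fun x y => a * gx x y + b * hx x y), (fun x y => a * gy x y + b * hy x y).
  repeat split; auto using dx_on_lin, dy_on_lin.
Qed.

Lemma Ck_sim (r k p q : R) (j : nat) (g : R -> R -> R) :
  0 < r -> p ^ 2 + q ^ 2 = r ^ 2 ->
  Ck j (ball0 r) g -> Ck j (ball0 1) (sim k p q g).
Proof.
  intros Hr Hpq. revert g. induction j as [|j IH]; intros g Hg.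
  - now apply (sim_cont r).
  - destruct Hg as (Hc & gx & gy & Hx & Hy & Kx & Ky).
    split; [now apply (sim_cont r)|].
    pose proof (Ck_cont _ _ _ Kx).
    do 2 eexists. split; [|split; [|split]].
    + apply (sim_dx r k p q Hr Hpq g gx gy); assumption.
    + apply (sim_dy r k p q Hr Hpq g gx gy); assumption.
    + apply Ck_lin; auto.
    + apply Ck_lin; auto.
Qed.

Lemma jet2_sim (r k p q : R) (g g1 g2 g11 g12 g22 : R -> R -> R) :
  0 < r -> p ^ 2 + q ^ 2 = r ^ 2 -> Ck 2 (ball0 r) g ->
  jet2 (ball0 r) g g1 g2 g11 g12 g22 ->
  jet2 (ball0 1) (sim k p q g)
    (fun x y => p * sim k p q g1 x y + q * sim k p q g2 x y)
    (fun x y => - q * sim k p q g1 x y + p * sim k p q g2 x y)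
    (fun x y => p ^ 2 * sim k p q g11 x y + 2 * p * q * sim k p q g12 x y
                + q ^ 2 * sim k p q g22 x y)
    (fun x y => p * q * (sim k p q g22 x y - sim k p q g11 x y)
                + (p ^ 2 - q ^ 2) * sim k p q g12 x y)
    (fun x y => q ^ 2 * sim k p q g11 x y - 2 * p * q * sim k p q g12 x y
                + p ^ 2 * sim k p q g22 x y).
Proof.
  intros Hr Hpq HC [J1 J2 J11 J12 J21 J22].
  pose proof (Ck_dx _ _ _ _ HC J1) as C1. pose proof (Ck_dy _ _ _ _ HC J2) as C2.
  pose proof (Ck_dx _ _ _ _ C1 J11) as C11. pose proof (Ck_dx _ _ _ _ C2 J21) as C21.
  pose proof (Ck_cont _ _ _ C1) as C1'.
  split.
  - now apply (sim_dx r).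
  - now apply (sim_dy r).
  - eapply dx_on_ext; [reflexivity| |apply dx_on_lin; apply (sim_dx r); eassumption].
    intros; cbv beta; ring.
  - eapply dy_on_ext; [reflexivity| |apply dy_on_lin; apply (sim_dy r); eassumption].
    intros; cbv beta; ring.
  - eapply dx_on_ext; [reflexivity| |apply dx_on_lin; apply (sim_dx r); eassumption].
    intros; cbv beta; ring.
  - eapply dy_on_ext; [reflexivity| |apply dy_on_lin; apply (sim_dy r); eassumption].
    intros; cbv beta; ring.
Qed.

(** * Maxima and derivative tests *)

Lemma square_maximum (a b : R) (g : R -> R -> R) :
  a <= b ->
  (forall x y, a <= x <= b -> a <= y <= b -> continuity_2d_pt g x y) ->
  exists x0 y0, a <= x0 <= b /\ a <= y0 <= b /\
    forall x y, a <= x <= b -> a <= y <= b -> g x y <= g x0 y0.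
Proof.
  intros Hab HC.
  (* Compactness turns pointwise tolerances [rad] into one [d] below all the tolerances that occur.
     It is used twice: [rad = 1 / (|g| + 1)] yields boundedness, and [rad = (T - g) / 2] shows that
     an unattained supremum [T] could be lowered by [d]. *)
  assert (choice : forall rad : R -> R -> R,
    (forall u v, a <= u <= b -> a <= v <= b -> 0 < rad u v) ->
    exists d : R, 0 < d /\ forall x y, a <= x <= b -> a <= y <= b ->
      exists u v, a <= u <= b /\ a <= v <= b /\ d <= rad u v /\
        Rabs (g x y - g u v) < rad u v).
  { intros rad Hrad.
    assert (Hex : forall u v, exists d : posreal, a <= u <= b -> a <= v <= b ->
      d <= rad u v /\ forall x y, Rabs (x - u) < d -> Rabs (y - v) < d ->
        Rabs (g x y - g u v) < rad u v).
    { intros u v. destruct (classic (a <= u <= b /\ a <= v <= b)) as [[Hu Hv]|Hn].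
      - destruct (HC u v Hu Hv (mkposreal _ (Hrad u v Hu Hv))) as [d Hd]. simpl in Hd.
        assert (Hp : 0 < Rmin d (rad u v)) by (apply Rmin_pos; [apply cond_pos|auto]).
        exists (mkposreal _ Hp). intros _ _. simpl. split; [apply Rmin_r|].
        pose proof (Rmin_l d (rad u v)).
        intros x y Hx Hy. apply Hd; lra.
      - exists (mkposreal 1 Rlt_0_1). intros; exfalso; auto. }
    set (delta := fun u v => proj1_sig (constructive_indefinite_description _ (Hex u v))).
    destruct (compactness_value_2d a b a b delta) as [d Hd].
    exists d. split; [apply cond_pos|]. intros x y Hx Hy.
    specialize (Hd x y Hx Hy). apply NNPP in Hd.
    destruct Hd as (u & v & Hu & Hv & Hxu & Hyv & Hduv).
    unfold delta in *.
    destruct (constructive_indefinite_description _ (Hex u v)) as [e He]; simpl in *.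
    destruct (He Hu Hv) as [He1 He2].
    exists u, v. repeat split; try lra; try (apply He2; assumption). }
  set (E := fun z => exists x y, a <= x <= b /\ a <= y <= b /\ z = g x y).
  assert (Hbd : bound E).
  { destruct (choice (fun u v => / (Rabs (g u v) + 1))) as (d & Hd & H).
    { intros u v _ _. apply Rinv_0_lt_compat. pose proof (Rabs_pos (g u v)). lra. }
    exists (/ d + 1). intros z (x & y & Hx & Hy & ->).
    destruct (H x y Hx Hy) as (u & v & Hu & Hv & Hdr & Hg).
    pose proof (Rabs_pos (g u v)) as Hp.
    assert (Rabs (g u v) + 1 <= / d).
    { rewrite <- (Rinv_inv (Rabs (g u v) + 1)). now apply Rinv_le_contravar. }
    assert (/ (Rabs (g u v) + 1) <= 1).
    { rewrite <- Rinv_1. apply Rinv_le_contravar; lra. }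
    pose proof (Rle_abs (g u v)). apply Rabs_def2 in Hg. lra. }
  destruct (completeness E Hbd) as [T [Tub Tleast]].
  { exists (g a a), a, a. repeat split; lra. }
  destruct (classic (exists x y, a <= x <= b /\ a <= y <= b /\ g x y = T))
    as [(x0 & y0 & Hx0 & Hy0 & HT)|Hno].
  - exists x0, y0. repeat split; try lra. intros x y Hx Hy. rewrite HT.
    apply Tub. now exists x, y.
  - exfalso.
    assert (Hlt : forall u v, a <= u <= b -> a <= v <= b -> 0 < (T - g u v) / 2).
    { intros u v Hu Hv.
      assert (g u v <= T) by (apply Tub; now exists u, v).
      assert (g u v <> T) by (intros HE; apply Hno; now exists u, v).
      lra. }
    destruct (choice (fun u v => (T - g u v) / 2) Hlt) as (d & Hd & H).
    assert (T <= T - d); [|lra].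
    apply Tleast. intros z (x & y & Hx & Hy & ->).
    destruct (H x y Hx Hy) as (u & v & Hu & Hv & Hdr & Hg).
    apply Rabs_def2 in Hg. lra.
Qed.

(** If [l > 0], then [g'] is positive just to the right of [t0], and by the mean value theorem [g]
    exceeds its maximum there. *)
Lemma second_derivative_test (g g' : R -> R) (t0 l : R) :
  locally t0 (fun t => g t <= g t0) ->
  locally t0 (fun t => is_derive g t (g' t)) ->
  is_derive g' t0 l -> g' t0 = 0 /\ l <= 0.
Proof.
  intros [d1 H1] [d2 H2] H3.
  assert (Hd : 0 < Rmin d1 d2) by (apply Rmin_pos; apply cond_pos).
  set (d := Rmin d1 d2) in *.
  pose proof (Rmin_l d1 d2) as Hl. pose proof (Rmin_r d1 d2) as Hr. fold d in Hl, Hr.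
  assert (Hmax : forall t, Rabs (t - t0) < d -> g t <= g t0).
  { intros t Ht. apply H1. apply Rlt_le_trans with d; assumption. }
  assert (Hder : forall t, Rabs (t - t0) < d -> is_derive g t (g' t)).
  { intros t Ht. apply H2. apply Rlt_le_trans with d; assumption. }
  assert (H0 : g' t0 = 0).
  { assert (D : derivable_pt_lim g t0 (g' t0)).
    { apply is_derive_Reals, Hder. rewrite Rminus_diag, Rabs_R0. exact Hd. }
    change (derive_pt g t0 (exist _ (g' t0) D) = 0).
    apply deriv_maximum with (t0 - d) (t0 + d); try lra.
    intros t Ht1 Ht2. apply Hmax, Rabs_def1; lra. }
  split; [exact H0|].
  apply Rnot_lt_le. intros Hlpos.
  apply is_derive_Reals in H3.
  destruct (H3 l Hlpos) as [e He].
  pose proof (cond_pos e) as Hepos.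
  set (t := t0 + Rmin d e / 2).
  pose proof (Rmin_l d e). pose proof (Rmin_r d e).
  assert (Hm : 0 < Rmin d e) by (apply Rmin_pos; lra).
  destruct (MVT_cor2 g g' t0 t) as (c & Hc & Hct).
  { unfold t; lra. }
  { intros c Hc. apply is_derive_Reals, Hder. unfold t in Hc. apply Rabs_def1; lra. }
  assert (0 < g' c).
  { specialize (He (c - t0)). rewrite H0 in He.
    replace (t0 + (c - t0)) with c in He by ring.
    unfold t in Hct.
    assert (Hq : Rabs ((g' c - 0) / (c - t0) - l) < l).
    { apply He; [lra|]. apply Rabs_def1; lra. }
    apply Rabs_def2 in Hq.
    replace (g' c) with ((g' c - 0) / (c - t0) * (c - t0)) by (field; lra).
    apply Rmult_lt_0_compat; lra. }
  assert (g t <= g t0) by (apply Hmax; unfold t; apply Rabs_def1; lra).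
  assert (0 < g' c * (t - t0)) by (apply Rmult_lt_0_compat; [lra|unfold t; lra]).
  lra.
Qed.

Lemma is_derive_Rid (x : R) : is_derive (fun t => t) x 1.
Proof. exact (is_derive_id x). Qed.

Lemma is_derive_Rconst (c x : R) : is_derive (fun _ => c) x 0.
Proof. exact (is_derive_const c x). Qed.

Lemma is_derive_Rplus (f g : R -> R) (x a b : R) :
  is_derive f x a -> is_derive g x b -> is_derive (fun t => f t + g t) x (a + b).
Proof. intros; now apply @is_derive_plus. Qed.

Lemma is_derive_Rminus (f g : R -> R) (x a b : R) :
  is_derive f x a -> is_derive g x b -> is_derive (fun t => f t - g t) x (a - b).
Proof. intros; now apply @is_derive_minus. Qed.

Lemma is_derive_Rmult (f g : R -> R) (x a b : R) :
  is_derive f x a -> is_derive g x b ->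
  is_derive (fun t => f t * g t) x (a * g x + f x * b).
Proof. intros; apply @is_derive_mult; auto. exact Rmult_comm. Qed.

Lemma is_derive_Rsqr (f : R -> R) (x a : R) :
  is_derive f x a -> is_derive (fun t => f t ^ 2) x (2 * f x * a).
Proof.
  intros H. evar_last; [apply (is_derive_pow f 2 x a H)|]. simpl. ring.
Qed.

Lemma log_product_test (s s' w w' v v' e e' : R -> R) (t0 s'' w'' v'' e'' : R) :
  locally t0 (fun t => 0 < s t /\ 0 < w t /\ 0 < v t) ->
  locally t0 (fun t => s t * w t ^ 4 * v t ^ 4 * exp (e t)
                <= s t0 * w t0 ^ 4 * v t0 ^ 4 * exp (e t0)) ->
  locally t0 (fun t => is_derive s t (s' t)) -> is_derive s' t0 s'' ->
  locally t0 (fun t => is_derive w t (w' t)) -> is_derive w' t0 w'' ->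
  locally t0 (fun t => is_derive v t (v' t)) -> is_derive v' t0 v'' ->
  locally t0 (fun t => is_derive e t (e' t)) -> is_derive e' t0 e'' ->
  s' t0 / s t0 + 4 * (w' t0 / w t0) + 4 * (v' t0 / v t0) + e' t0 = 0 /\
  s'' / s t0 - (s' t0 / s t0) ^ 2 + 4 * (w'' / w t0 - (w' t0 / w t0) ^ 2)
    + 4 * (v'' / v t0 - (v' t0 / v t0) ^ 2) + e'' <= 0.
Proof.
  intros Hpos Hmax Ds Ds' Dw Dw' Dv Dv' De De'.
  apply (second_derivative_test
    (fun t => ln (s t) + 4 * ln (w t) + 4 * ln (v t) + e t)
    (fun t => s' t / s t + 4 * (w' t / w t) + 4 * (v' t / v t) + e' t)).
  - pose proof (locally_singleton _ _ Hpos) as (Hs0 & Hw0 & Hv0).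
    generalize (filter_and _ _ Hpos Hmax). apply filter_imp.
    intros t [(Hs & Hw & Hv) Hm].
    assert (Hln : forall a b c z, 0 < a -> 0 < b -> 0 < c ->
      ln (a * b ^ 4 * c ^ 4 * exp z) = ln a + 4 * ln b + 4 * ln c + z).
    { intros a b c z Ha Hb Hc.
      assert (Hb4 : 0 < b ^ 4) by now apply pow_lt.
      assert (Hc4 : 0 < c ^ 4) by now apply pow_lt.
      rewrite !ln_mult, !ln_pow, ln_exp; auto using exp_pos, Rmult_lt_0_compat.
      simpl INR. ring. }
    rewrite <- (Hln (s t) (w t) (v t) (e t)) by assumption.
    rewrite <- (Hln (s t0) (w t0) (v t0) (e t0)) by assumption.
    apply ln_le; [|exact Hm].
    apply Rmult_lt_0_compat; [|apply exp_pos].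
    apply Rmult_lt_0_compat; [|now apply pow_lt].
    apply Rmult_lt_0_compat; [assumption|now apply pow_lt].
  - generalize (filter_and _ _ Hpos (filter_and _ _ (filter_and _ _ Ds Dw)
      (filter_and _ _ Dv De))). apply filter_imp.
    intros t [(Hs & Hw & Hv) [[D1 D2] [D3 D4]]].
    assert (Dln : forall (z : R -> R) l, 0 < z t -> is_derive z t l ->
      is_derive (fun t => ln (z t)) t (l / z t)).
    { intros z l Hz Dz. apply (is_derive_comp ln z t (/ z t) l); [|exact Dz].
      now apply is_derive_Reals, derivable_pt_lim_ln. }
    apply is_derive_Rplus; [|assumption].
    apply is_derive_Rplus; [apply is_derive_Rplus|];
      [|apply is_derive_scal|apply is_derive_scal]; auto.
  - pose proof (locally_singleton _ _ Hpos) as (Hs0 & Hw0 & Hv0).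
    pose proof (locally_singleton _ _ Ds) as D1.
    pose proof (locally_singleton _ _ Dw) as D2.
    pose proof (locally_singleton _ _ Dv) as D3.
    simpl in D1, D2, D3.
    assert (Dq : forall (z z' : R -> R) l, 0 < z t0 -> is_derive z t0 (z' t0) ->
      is_derive z' t0 l ->
      is_derive (fun t => z' t / z t) t0 (l / z t0 - (z' t0 / z t0) ^ 2)).
    { intros z z' l Hz Dz Dz'.
      replace (l / z t0 - (z' t0 / z t0) ^ 2)
        with ((l * z t0 - z' t0 * z' t0) / z t0 ^ 2) by (field; lra).
      apply is_derive_div; auto. lra. }
    apply is_derive_Rplus; [|assumption].
    apply is_derive_Rplus; [apply is_derive_Rplus|];
      [|apply is_derive_scal|apply is_derive_scal]; auto.
Qed.

Lemma jet2_ext (r : R) (g g1 g2 g11 g12 g22 h1 h2 h11 h12 h22 : R -> R -> R) :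
  (forall x y, ball0 r x y -> g1 x y = h1 x y) ->
  (forall x y, ball0 r x y -> g2 x y = h2 x y) ->
  (forall x y, ball0 r x y -> g11 x y = h11 x y) ->
  (forall x y, ball0 r x y -> g12 x y = h12 x y) ->
  (forall x y, ball0 r x y -> g22 x y = h22 x y) ->
  jet2 (ball0 r) g g1 g2 g11 g12 g22 -> jet2 (ball0 r) g h1 h2 h11 h12 h22.
Proof.
  intros E1 E2 E11 E12 E22 [J1 J2 J11 J12 J21 J22].
  split; (eapply dx_on_ext || eapply dy_on_ext); try eassumption; reflexivity.
Qed.

(** The shared names encode the symmetry of the third and fourth derivatives. Schwarz's theorem is
    applied only at third order; at fourth order the equalities follow from uniqueness of the
    derivative and the symmetry inside each jet. *)
Lemma jet4_exists (r : R) (u u1 u2 u11 u12 u22 : R -> R -> R) :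
  Ck 4 (ball0 r) u -> jet2 (ball0 r) u u1 u2 u11 u12 u22 ->
  exists a b c d e0 e1 e2 e3 e4,
    jet2 (ball0 r) u11 a b e0 e1 e2 /\ jet2 (ball0 r) u12 b c e1 e2 e3 /\
    jet2 (ball0 r) u22 c d e2 e3 e4.
Proof.
  intros HC [J1 J2 J11 J12 J21 J22].
  pose proof (Ck_dx _ _ _ _ HC J1) as C1. pose proof (Ck_dy _ _ _ _ HC J2) as C2.
  pose proof (Ck_dx _ _ _ _ C1 J11) as C11. pose proof (Ck_dy _ _ _ _ C1 J12) as C12.
  pose proof (Ck_dy _ _ _ _ C2 J22) as C22.
  destruct (jet2_exists r u11 C11) as (a & b & e0 & e1 & e2 & JA).
  destruct (jet2_exists r u12 C12) as (b' & c & e1' & e2' & e3 & JB).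
  destruct (jet2_exists r u22 C22) as (c' & d & e2'' & e3' & e4 & JC).
  assert (Eb : forall x y, ball0 r x y -> b' x y = b x y).
  { apply (mixed_partials_eq r u1 u11 u12); try assumption.
    - apply JA.
    - apply JB.
    - exact (Ck_cont _ _ _ (Ck_dy _ _ _ _ C11 (jet_2 _ _ _ _ _ _ _ JA))).
    - exact (Ck_cont _ _ _ (Ck_dx _ _ _ _ C12 (jet_1 _ _ _ _ _ _ _ JB))). }
  assert (Ec : forall x y, ball0 r x y -> c' x y = c x y).
  { apply (mixed_partials_eq r u2 u12 u22); try assumption.
    - apply JB.
    - apply JC.
    - exact (Ck_cont _ _ _ (Ck_dy _ _ _ _ C12 (jet_2 _ _ _ _ _ _ _ JB))).
    - exact (Ck_cont _ _ _ (Ck_dx _ _ _ _ C22 (jet_1 _ _ _ _ _ _ _ JC))). }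
  assert (E1 : forall x y, ball0 r x y -> e1' x y = e1 x y).
  { apply (dx_on_unique _ b); [|apply JA].
    eapply dx_on_ext; [exact Eb|reflexivity|apply JB]. }
  assert (E2 : forall x y, ball0 r x y -> e2' x y = e2 x y).
  { apply (dy_on_unique _ b); [|apply JA].
    eapply dy_on_ext; [exact Eb|reflexivity|apply JB]. }
  assert (E2' : forall x y, ball0 r x y -> e2'' x y = e2 x y).
  { intros x y Hxy. rewrite <- E2 by assumption. revert x y Hxy.
    apply (dx_on_unique _ c); [|apply JB].
    eapply dx_on_ext; [exact Ec|reflexivity|apply JC]. }
  assert (E3 : forall x y, ball0 r x y -> e3' x y = e3 x y).
  { apply (dy_on_unique _ c); [|apply JB].
    eapply dy_on_ext; [exact Ec|reflexivity|apply JC]. }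
  exists a, b, c, d, e0, e1, e2, e3, e4. split; [exact JA|split].
  - eapply jet2_ext; [..|exact JB]; auto.
  - eapply jet2_ext; [..|exact JC]; auto.
Qed.

Ltac der :=
  lazymatch goal with
  | |- is_derive (fun t => @?f t + @?g t) _ _ => eapply (is_derive_Rplus f g); der
  | |- is_derive (fun t => @?f t - @?g t) _ _ => eapply (is_derive_Rminus f g); der
  | |- is_derive (fun t => @?f t * @?g t) _ _ => eapply (is_derive_Rmult f g); der
  | |- is_derive (fun t => @?f t ^ 2) _ _ => eapply (is_derive_Rsqr f); der
  | |- is_derive (fun t => t) _ _ => apply is_derive_Rid
  | |- is_derive (fun _ => ?c) _ _ => apply is_derive_Rconst
  | H : dx_on _ ?g _ |- is_derive (fun t => ?g t _) _ _ =>
      apply is_derive_Reals; apply H; assumption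
  | H : dy_on _ ?g _ |- is_derive (fun t => ?g _ t) _ _ =>
      apply is_derive_Reals; apply H; assumption
  end.

Ltac derive_by_rules :=
  evar_last; [der|cbv beta; field].

(** The derivatives [Q1], [Q2] of the quotient [N / s] are not given by formulas but by the Leibniz
    identities for [N = Q s]. This keeps them free of denominators, in the form that
    [maximum_point_bound] takes as hypotheses. *)
Lemma line_test (s s' N N' rho rho' e e' : R -> R) (t0 s2 N2 rho2 e2 : R) :
  let Q := N t0 / s t0 in
  let w := 1 / 8 - Q in
  let v := 1 / 8 - (rho t0 - Q) in
  locally t0 (fun t => 0 < s t) -> 0 < w -> 0 < v ->
  locally t0 (fun t => 0 < 1 / 8 - N t / s t -> 0 < 1 / 8 - (rho t - N t / s t) ->
    s t * (1 / 8 - N t / s t) ^ 4 * (1 / 8 - (rho t - N t / s t)) ^ 4 * exp (e t)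
    <= s t0 * w ^ 4 * v ^ 4 * exp (e t0)) ->
  locally t0 (fun t => is_derive s t (s' t)) -> is_derive s' t0 s2 ->
  locally t0 (fun t => is_derive N t (N' t)) -> is_derive N' t0 N2 ->
  locally t0 (fun t => is_derive rho t (rho' t)) -> is_derive rho' t0 rho2 ->
  locally t0 (fun t => is_derive e t (e' t)) -> is_derive e' t0 e2 ->
  exists Q1 Q2,
    Q1 * s t0 + Q * s' t0 = N' t0 /\
    Q2 * s t0 + 2 * Q1 * s' t0 + Q * s2 = N2 /\
    s' t0 / s t0 - 4 * (Q1 / w) + 4 * ((Q1 - rho' t0) / v) + e' t0 = 0 /\
    s2 / s t0 - (s' t0 / s t0) ^ 2 - 4 * (Q2 / w + (Q1 / w) ^ 2)
      + 4 * ((Q2 - rho2) / v - ((Q1 - rho' t0) / v) ^ 2) + e2 <= 0.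
Proof.
  intros Q w v Hs Hw Hv Hmax Ds Ds' DN DN' Dr Dr' De De'.
  pose proof (locally_singleton _ _ Hs) as Hs0; simpl in Hs0.
  set (Qf := fun t => N t / s t).
  set (Qf' := fun t => (N' t - Qf t * s' t) / s t).
  assert (DQ : locally t0 (fun t => is_derive Qf t (Qf' t))).
  { generalize (filter_and _ _ Hs (filter_and _ _ Ds DN)). apply filter_imp.
    intros t (Hst & D1 & D2). unfold Qf', Qf.
    replace ((N' t - N t / s t * s' t) / s t)
      with ((N' t * s t - s' t * N t) / s t ^ 2) by (field; lra).
    evar_last; [apply is_derive_div; [exact D2|exact D1|lra]|]. field. lra. }
  set (q1 := Qf' t0).
  set (q2 := (N2 - 2 * q1 * s' t0 - Q * s2) / s t0).
  assert (DQ' : is_derive Qf' t0 q2).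
  { pose proof (locally_singleton _ _ DQ) as D1; simpl in D1.
    pose proof (locally_singleton _ _ Ds) as D2; simpl in D2.
    unfold Qf'. evar_last.
    - apply is_derive_div; [|exact D2|lra].
      apply is_derive_Rminus; [exact DN'|].
      apply is_derive_Rmult; [exact D1|exact Ds'].
    - fold q1. unfold q2, Q. fold (Qf t0).
      replace (N' t0) with (q1 * s t0 + Qf t0 * s' t0)
        by (unfold q1, Qf'; field; lra).
      field. lra. }
  exists q1, q2.
  split; [unfold q1, Qf', Q; fold (Qf t0); field; lra|].
  split; [unfold q2; field; lra|].
  (* The maximum property is assumed only where both cut-offs are positive; by continuity this is a
     neighbourhood of [t0]. *)
  assert (pos_near : forall g : R -> R, continuous g t0 -> 0 < g t0 ->
    locally t0 (fun t => 0 < g t)).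
  { intros g Hg Hg0. apply Hg. apply (open_gt 0). exact Hg0. }
  assert (Dw : locally t0 (fun t => 0 < 1 / 8 - Qf t)).
  { apply pos_near; [|exact Hw]. apply (ex_derive_continuous (V := R_NormedModule)).
    exists (0 - q1).
    apply is_derive_Rminus; [apply is_derive_Rconst|apply (locally_singleton _ _ DQ)]. }
  assert (Dv : locally t0 (fun t => 0 < 1 / 8 - (rho t - Qf t))).
  { apply pos_near; [|exact Hv]. apply (ex_derive_continuous (V := R_NormedModule)).
    exists (0 - (rho' t0 - q1)).
    apply is_derive_Rminus; [apply is_derive_Rconst|].
    apply is_derive_Rminus; [apply (locally_singleton _ _ Dr)|].
    apply (locally_singleton _ _ DQ). }
  destruct (log_product_test s s' (fun t => 1 / 8 - Qf t) (fun t => 0 - Qf' t)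
    (fun t => 1 / 8 - (rho t - Qf t)) (fun t => 0 - (rho' t - Qf' t)) e e' t0
    s2 (0 - q2) (0 - (rho2 - q2)) e2) as [F1 F2]; try assumption.
  - generalize (filter_and _ _ Hs (filter_and _ _ Dw Dv)). apply filter_imp. auto.
  - generalize (filter_and _ _ Hmax (filter_and _ _ Dw Dv)). apply filter_imp.
    intros t (H1 & H2 & H3). now apply H1.
  - revert DQ. apply filter_imp. intros t D.
    apply is_derive_Rminus; [apply is_derive_Rconst|exact D].
  - apply is_derive_Rminus; [apply is_derive_Rconst|exact DQ'].
  - generalize (filter_and _ _ Dr DQ). apply filter_imp. intros t [D1 D2].
    apply is_derive_Rminus; [apply is_derive_Rconst|].
    apply is_derive_Rminus; assumption.
  - apply is_derive_Rminus; [apply is_derive_Rconst|].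
    apply is_derive_Rminus; assumption.
  - cbv beta in F1, F2. fold q1 in F1, F2. change (Qf t0) with Q in F1, F2.
    fold w v in F1, F2. split.
    + rewrite <- F1. field. lra.
    + eapply Rle_trans; [|exact F2]. right. field. lra.
Qed.

(** * Solutions and their invariance under similarities *)

(** All bounds are scale invariant and use Euclidean or Frobenius norms, which rotations preserve,
    so [A], [B], [K] survive every similarity. Convexity is recorded as a positive trace, which
    together with [det > 0] makes both eigenvalues positive. *)
Record solution (r A B K m M : R)
  (u f u1 u2 u11 u12 u22 f1 f2 f11 f12 f22 : R -> R -> R) : Prop := {
  sol_Cu : Ck 4 (ball0 r) u;
  sol_ju : jet2 (ball0 r) u u1 u2 u11 u12 u22;
  sol_Cf : Ck 2 (ball0 r) f;
  sol_jf : jet2 (ball0 r) f f1 f2 f11 f12 f22;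
  sol_f : forall x y, ball0 r x y -> m <= f x y <= M;
  sol_det : forall x y, ball0 r x y -> u11 x y * u22 x y - u12 x y ^ 2 = f x y;
  sol_tr : forall x y, ball0 r x y -> 0 < u11 x y + u22 x y;
  sol_grad : forall x y, ball0 r x y -> r ^ 2 * (f1 x y ^ 2 + f2 x y ^ 2) <= A ^ 2;
  sol_hess : forall x y, ball0 r x y ->
    r ^ 4 * (f11 x y ^ 2 + 2 * f12 x y ^ 2 + f22 x y ^ 2) <= B ^ 2;
  sol_K : forall x y, ball0 r x y -> u1 x y ^ 2 + u2 x y ^ 2 <= K ^ 2 * r ^ 2 }.

(** The factor [k = 1 / r^2] compensates the two derivatives in [D^2u]: the Hessian is only rotated,
    so the determinant equation holds with [f] merely composed with the similarity. *)
Lemma solution_sim (r p q A B K m M : R)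
  (u f u1 u2 u11 u12 u22 f1 f2 f11 f12 f22 : R -> R -> R) :
  0 < r -> p ^ 2 + q ^ 2 = r ^ 2 ->
  solution r A B K m M u f u1 u2 u11 u12 u22 f1 f2 f11 f12 f22 ->
  let k := / r ^ 2 in
  solution 1 A B K m M (sim k p q u) (sim 1 p q f)
    (fun x y => p * sim k p q u1 x y + q * sim k p q u2 x y)
    (fun x y => - q * sim k p q u1 x y + p * sim k p q u2 x y)
    (fun x y => p ^ 2 * sim k p q u11 x y + 2 * p * q * sim k p q u12 x y
                + q ^ 2 * sim k p q u22 x y)
    (fun x y => p * q * (sim k p q u22 x y - sim k p q u11 x y)
                + (p ^ 2 - q ^ 2) * sim k p q u12 x y)
    (fun x y => q ^ 2 * sim k p q u11 x y - 2 * p * q * sim k p q u12 x y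
                + p ^ 2 * sim k p q u22 x y)
    (fun x y => p * sim 1 p q f1 x y + q * sim 1 p q f2 x y)
    (fun x y => - q * sim 1 p q f1 x y + p * sim 1 p q f2 x y)
    (fun x y => p ^ 2 * sim 1 p q f11 x y + 2 * p * q * sim 1 p q f12 x y
                + q ^ 2 * sim 1 p q f22 x y)
    (fun x y => p * q * (sim 1 p q f22 x y - sim 1 p q f11 x y)
                + (p ^ 2 - q ^ 2) * sim 1 p q f12 x y)
    (fun x y => q ^ 2 * sim 1 p q f11 x y - 2 * p * q * sim 1 p q f12 x y
                + p ^ 2 * sim 1 p q f22 x y).
Proof.
  intros Hr Hpq [Cu Ju Cf Jf Hf Hdet Htr Hgrad Hhess HK] k.
  assert (Hr2 : 0 < r ^ 2) by now apply pow_lt.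
  assert (Hk : k * (p ^ 2 + q ^ 2) = 1) by (rewrite Hpq; unfold k; field; lra).
  split.
  - now apply (Ck_sim r).
  - apply (jet2_sim r); auto. now do 2 apply Ck_pred.
  - now apply (Ck_sim r).
  - now apply (jet2_sim r).
  - intros x y Hxy. unfold sim. rewrite Rmult_1_l. now apply Hf, sim_ball0.
  - intros x y Hxy. apply (sim_ball0 r p q) in Hxy; [|assumption..].
    unfold sim. rewrite <- (Hdet _ _ Hxy).
    transitivity ((k * (p ^ 2 + q ^ 2)) ^ 2 *
      (u11 (p * x - q * y) (q * x + p * y) * u22 (p * x - q * y) (q * x + p * y)
       - u12 (p * x - q * y) (q * x + p * y) ^ 2)); [ring|].
    rewrite Hk. ring.
  - intros x y Hxy. apply (sim_ball0 r p q) in Hxy; [|assumption..].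
    unfold sim. apply Htr in Hxy. eapply Rlt_le_trans; [exact Hxy|]. right.
    transitivity ((k * (p ^ 2 + q ^ 2)) *
      (u11 (p * x - q * y) (q * x + p * y) + u22 (p * x - q * y) (q * x + p * y)));
      [rewrite Hk; ring|ring].
  - intros x y Hxy. apply (sim_ball0 r p q) in Hxy; [|assumption..].
    unfold sim. eapply Rle_trans; [|apply (Hgrad _ _ Hxy)]. right.
    rewrite <- Hpq. ring.
  - intros x y Hxy. apply (sim_ball0 r p q) in Hxy; [|assumption..].
    unfold sim. eapply Rle_trans; [|apply (Hhess _ _ Hxy)]. right.
    replace (r ^ 4) with ((r ^ 2) ^ 2) by ring. rewrite <- Hpq. ring.
  - intros x y Hxy. apply (sim_ball0 r p q) in Hxy; [|assumption..].
    unfold sim. apply HK in Hxy.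
    apply (Rmult_le_compat_l (k ^ 2 * (p ^ 2 + q ^ 2))) in Hxy.
    2:{ rewrite Hpq. apply Rmult_le_pos; [apply pow2_ge_0|lra]. }
    eapply Rle_trans; [|eapply Rle_trans; [exact Hxy|]]; right; [ring|].
    rewrite <- Hpq. transitivity (K ^ 2 * (k * (p ^ 2 + q ^ 2)) ^ 2); [ring|].
    rewrite Hk. ring.
Qed.

(** * The test function at its maximum *)

Definition cof_num (p q t x y : R) : R := t * x ^ 2 - 2 * q * x * y + p * y ^ 2.

Definition cof_quot (u11 u12 u22 : R -> R -> R) (x y : R) : R :=
  cof_num (u11 x y) (u12 x y) (u22 x y) x y / (u11 x y + u22 x y).

(** The truncation by [Rmax] matters because both bare brackets may be negative: the product of
    their even powers would then be positive outside the intended support. *)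
Definition test_fn (C0 : R) (u1 u2 u11 u12 u22 : R -> R -> R) (x y : R) : R :=
  (u11 x y + u22 x y)
  * Rmax 0 (1 / 8 - cof_quot u11 u12 u22 x y) ^ 4
  * Rmax 0 (1 / 8 - (x ^ 2 + y ^ 2 - cof_quot u11 u12 u22 x y)) ^ 4
  * exp (C0 / 2 * (u1 x y ^ 2 + u2 x y ^ 2)).

Lemma monge_ampere_jet (r : R)
  (f f1 f2 f11 f12 f22 p q t a b c d e0 e1 e2 e3 e4 : R -> R -> R) :
  (forall x y, ball0 r x y -> p x y * t x y - q x y ^ 2 = f x y) ->
  jet2 (ball0 r) f f1 f2 f11 f12 f22 ->
  jet2 (ball0 r) p a b e0 e1 e2 -> jet2 (ball0 r) q b c e1 e2 e3 ->
  jet2 (ball0 r) t c d e2 e3 e4 ->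
  forall x y, ball0 r x y -> q x y = 0 ->
  t x y * a x y + p x y * c x y = f1 x y /\
  t x y * b x y + p x y * d x y = f2 x y /\
  t x y * e0 x y + p x y * e2 x y + 2 * (a x y * c x y - b x y ^ 2) = f11 x y /\
  t x y * e1 x y + p x y * e3 x y + a x y * d x y - b x y * c x y = f12 x y /\
  t x y * e2 x y + p x y * e4 x y + 2 * (b x y * d x y - c x y ^ 2) = f22 x y.
Proof.
  intros Hdet [F1 F2 F11 F12 F21 F22] [P1 P2 P11 P12 P21 P22] [Q1 Q2 Q11 Q12 Q21 Q22]
    [T1 T2 T11 T12 T21 T22] x y Hxy Hq.
  (* The terms containing [q] must be kept until the last differentiation, since [q] vanishes only
     at the one point considered; they produce [- b^2], [- b c] and [- c^2]. *)
  assert (G1 : forall x y, ball0 r x y ->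
    a x y * t x y + p x y * c x y - 2 * q x y * b x y = f1 x y).
  { apply (dx_on_unique _ f); [|exact F1].
    eapply dx_on_ext; [exact Hdet|reflexivity|].
    intros x' y' H'. apply is_derive_Reals. derive_by_rules. }
  assert (G2 : forall x y, ball0 r x y ->
    b x y * t x y + p x y * d x y - 2 * q x y * c x y = f2 x y).
  { apply (dy_on_unique _ f); [|exact F2].
    eapply dy_on_ext; [exact Hdet|reflexivity|].
    intros x' y' H'. apply is_derive_Reals. derive_by_rules. }
  assert (G11 : forall x y, ball0 r x y ->
    e0 x y * t x y + p x y * e2 x y + 2 * (a x y * c x y - b x y ^ 2)
    - 2 * q x y * e1 x y = f11 x y).
  { apply (dx_on_unique _ f1); [|exact F11].
    eapply dx_on_ext; [exact G1|reflexivity|].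
    intros x' y' H'. apply is_derive_Reals. derive_by_rules. }
  assert (G12 : forall x y, ball0 r x y ->
    e1 x y * t x y + p x y * e3 x y + a x y * d x y - b x y * c x y
    - 2 * q x y * e2 x y = f12 x y).
  { apply (dy_on_unique _ f1); [|exact F12].
    eapply dy_on_ext; [exact G1|reflexivity|].
    intros x' y' H'. apply is_derive_Reals. derive_by_rules. }
  assert (G22 : forall x y, ball0 r x y ->
    e2 x y * t x y + p x y * e4 x y + 2 * (b x y * d x y - c x y ^ 2)
    - 2 * q x y * e3 x y = f22 x y).
  { apply (dy_on_unique _ f2); [|exact F22].
    eapply dy_on_ext; [exact G2|reflexivity|].
    intros x' y' H'. apply is_derive_Reals. derive_by_rules. }
  specialize (G1 x y Hxy). specialize (G2 x y Hxy). specialize (G11 x y Hxy).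
  specialize (G12 x y Hxy). specialize (G22 x y Hxy). rewrite Hq in *.
  repeat apply conj; lra.
Qed.

Lemma ball0_half_unit (x y : R) : ball0 (1 / 2) x y -> ball0 1 x y.
Proof. unfold ball0. lra. Qed.

(** The maximum is taken over a disc because a disc, unlike the square on which the maximum is
    found, is preserved by the rotation that makes [u12] vanish at the point. *)
Lemma diagonal_maximum_bound (m M A B : R) :
  0 < m -> m <= M -> 0 <= A -> 0 <= B ->
  exists eps : R, 0 < eps /\
  forall K u f u1 u2 u11 u12 u22 f1 f2 f11 f12 f22 x0 y0,
  0 <= K ->
  solution 1 A B K m M u f u1 u2 u11 u12 u22 f1 f2 f11 f12 f22 ->
  ball0 (1 / 2) x0 y0 -> u12 x0 y0 = 0 ->
  let Q := cof_quot u11 u12 u22 x0 y0 in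
  let w := 1 / 8 - Q in let v := 1 / 8 - (x0 ^ 2 + y0 ^ 2 - Q) in
  0 < w -> 0 < v ->
  (forall x y, ball0 (1 / 2) x y ->
    test_fn (73 / m) u1 u2 u11 u12 u22 x y
    <= test_fn (73 / m) u1 u2 u11 u12 u22 x0 y0) ->
  eps * (u11 x0 y0 * (w * v) ^ 2) <= (1 + K) ^ 2.
Proof.
  intros Hm HmM HA HB.
  destruct (maximum_point_bound m M A B Hm HmM HA HB) as (eps & Heps & bound).
  exists eps. split; [exact Heps|].
  intros K u f u1 u2 u11 u12 u22 f1 f2 f11 f12 f22 x0 y0 HK0
    [Cu Ju Cf Jf Hf Hdet Htr Hgrad Hhess HK] Hin H12 Q w v Hw Hv Hmax.
  destruct (jet4_exists 1 u u1 u2 u11 u12 u22 Cu Ju)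
    as (a & b & c & d & e0 & e1 & e2 & e3 & e4 & JP & JQ & JT).
  pose proof (ball0_half_unit _ _ Hin) as Hin1.
  destruct (monge_ampere_jet 1 f f1 f2 f11 f12 f22 u11 u12 u22 a b c d e0 e1 e2 e3 e4
    Hdet Jf JP JQ JT x0 y0 Hin1 H12) as (E1 & E2 & E11 & E12 & E22).
  set (C0 := 73 / m) in *.
  destruct Ju as [J1 J2 J11 J12 J21 J22]. destruct JP as [P1 P2 P11 P12 P21 P22].
  destruct JQ as [Q1 Q2 Q11 Q12 Q21 Q22]. destruct JT as [T1 T2 T11 T12 T21 T22].
  pose proof (Hdet _ _ Hin1) as Hd0. pose proof (Hf _ _ Hin1) as Hf0.
  pose proof (Htr _ _ Hin1) as Ht0. rewrite H12 in Hd0.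
  assert (Hpos : 0 < u11 x0 y0 /\ 0 < u22 x0 y0).
  { assert (0 < u11 x0 y0 * u22 x0 y0) by lra. split; nra. }
  destruct Hpos as [Hlam Hmu].
  assert (Htest : forall x y, ball0 (1 / 2) x y ->
    let q := cof_num (u11 x y) (u12 x y) (u22 x y) x y / (u11 x y + u22 x y) in
    0 < 1 / 8 - q -> 0 < 1 / 8 - (x ^ 2 + y ^ 2 - q) ->
    (u11 x y + u22 x y) * (1 / 8 - q) ^ 4 * (1 / 8 - (x ^ 2 + y ^ 2 - q)) ^ 4
      * exp (C0 / 2 * (u1 x y ^ 2 + u2 x y ^ 2))
    <= (u11 x0 y0 + u22 x0 y0) * w ^ 4 * v ^ 4
      * exp (C0 / 2 * (u1 x0 y0 ^ 2 + u2 x0 y0 ^ 2))).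
  { intros x y Hxy q Hq1 Hq2. specialize (Hmax x y Hxy).
    unfold test_fn in Hmax. fold Q in Hmax. fold w in Hmax. fold v in Hmax.
    change (cof_quot u11 u12 u22 x y) with q in Hmax.
    rewrite !Rmax_right in Hmax by lra. exact Hmax. }
  (* As the Hessian is diagonal at the point, [L] contains no mixed derivative, and tests along the
     two coordinate lines capture it completely. *)
  destruct (line_test (fun t => u11 t y0 + u22 t y0) (fun t => a t y0 + c t y0)
    (fun t => cof_num (u11 t y0) (u12 t y0) (u22 t y0) t y0)
    (fun t => c t y0 * t ^ 2 + 2 * u22 t y0 * t - 2 * (b t y0 * t + u12 t y0) * y0
              + a t y0 * y0 ^ 2)
    (fun t => t ^ 2 + y0 ^ 2) (fun t => 2 * t)
    (fun t => C0 / 2 * (u1 t y0 ^ 2 + u2 t y0 ^ 2))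
    (fun t => C0 * (u1 t y0 * u11 t y0 + u2 t y0 * u12 t y0)) x0
    (e0 x0 y0 + e2 x0 y0)
    (e2 x0 y0 * x0 ^ 2 + 4 * c x0 y0 * x0 + 2 * u22 x0 y0 - 2 * e1 x0 y0 * x0 * y0
     - 4 * b x0 y0 * y0 + e0 x0 y0 * y0 ^ 2) 2
    (C0 * (u11 x0 y0 ^ 2 + u1 x0 y0 * a x0 y0 + u12 x0 y0 ^ 2 + u2 x0 y0 * b x0 y0)))
    as (q1 & q11 & X1 & X2 & X3 & X4).
  { apply filter_imp with (2 := ball0_locally_x _ _ _ Hin1). intros t Ht. now apply Htr. }
  { exact Hw. }
  { exact Hv. }
  { apply filter_imp with (2 := ball0_locally_x _ _ _ Hin). intros t Ht.
    exact (Htest t y0 Ht). }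
  { apply filter_imp with (2 := ball0_locally_x _ _ _ Hin1). intros t Ht. derive_by_rules. }
  { derive_by_rules. }
  { apply filter_imp with (2 := ball0_locally_x _ _ _ Hin1). intros t Ht.
    unfold cof_num. derive_by_rules. }
  { derive_by_rules. }
  { apply filter_imp with (2 := ball0_locally_x _ _ _ Hin1). intros t Ht. derive_by_rules. }
  { derive_by_rules. }
  { apply filter_imp with (2 := ball0_locally_x _ _ _ Hin1). intros t Ht.
    derive_by_rules. }
  { derive_by_rules. }
  destruct (line_test (fun t => u11 x0 t + u22 x0 t) (fun t => b x0 t + d x0 t)
    (fun t => cof_num (u11 x0 t) (u12 x0 t) (u22 x0 t) x0 t)
    (fun t => d x0 t * x0 ^ 2 - 2 * (c x0 t * t + u12 x0 t) * x0
              + b x0 t * t ^ 2 + 2 * u11 x0 t * t)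
    (fun t => x0 ^ 2 + t ^ 2) (fun t => 2 * t)
    (fun t => C0 / 2 * (u1 x0 t ^ 2 + u2 x0 t ^ 2))
    (fun t => C0 * (u1 x0 t * u12 x0 t + u2 x0 t * u22 x0 t)) y0
    (e2 x0 y0 + e4 x0 y0)
    (e4 x0 y0 * x0 ^ 2 - 2 * e3 x0 y0 * x0 * y0 - 4 * c x0 y0 * x0
     + e2 x0 y0 * y0 ^ 2 + 4 * b x0 y0 * y0 + 2 * u11 x0 y0) 2
    (C0 * (u22 x0 y0 ^ 2 + u1 x0 y0 * c x0 y0 + u12 x0 y0 ^ 2 + u2 x0 y0 * d x0 y0)))
    as (q2 & q22 & Y1 & Y2 & Y3 & Y4).
  { apply filter_imp with (2 := ball0_locally_y _ _ _ Hin1). intros t Ht. now apply Htr. }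
  { exact Hw. }
  { exact Hv. }
  { apply filter_imp with (2 := ball0_locally_y _ _ _ Hin). intros t Ht.
    exact (Htest x0 t Ht). }
  { apply filter_imp with (2 := ball0_locally_y _ _ _ Hin1). intros t Ht. derive_by_rules. }
  { derive_by_rules. }
  { apply filter_imp with (2 := ball0_locally_y _ _ _ Hin1). intros t Ht.
    unfold cof_num. derive_by_rules. }
  { derive_by_rules. }
  { apply filter_imp with (2 := ball0_locally_y _ _ _ Hin1). intros t Ht. derive_by_rules. }
  { derive_by_rules. }
  { apply filter_imp with (2 := ball0_locally_y _ _ _ Hin1). intros t Ht.
    derive_by_rules. }
  { derive_by_rules. }
  fold (cof_quot u11 u12 u22 x0 y0) in X1, X2, X3, X4, Y1, Y2, Y3, Y4.
  fold Q in X1, X2, X3, X4, Y1, Y2, Y3, Y4.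
  fold w in X3, X4, Y3, Y4. fold v in X3, X4, Y3, Y4.
  rewrite H12 in *.
  assert (HQ : Q * (u11 x0 y0 + u22 x0 y0) = u22 x0 y0 * x0 ^ 2 + u11 x0 y0 * y0 ^ 2).
  { unfold Q, cof_quot, cof_num. rewrite H12. field. lra. }
  specialize (Hgrad _ _ Hin1). specialize (Hhess _ _ Hin1). specialize (HK _ _ Hin1).
  rewrite pow1, Rmult_1_l in Hgrad, Hhess. rewrite pow1, Rmult_1_r in HK.
  unfold ball0 in Hin.
  apply (bound (u11 x0 y0) (u22 x0 y0) (a x0 y0) (b x0 y0) (c x0 y0) (d x0 y0)
    (e0 x0 y0) (e1 x0 y0) (e2 x0 y0) (e3 x0 y0) (e4 x0 y0) x0 y0
    (f1 x0 y0) (f2 x0 y0) (f11 x0 y0) (f12 x0 y0) (f22 x0 y0)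
    (u1 x0 y0) (u2 x0 y0) K Q q1 q2 q11 q22 w v); try assumption; try reflexivity;
    try (apply Rabs_le_of_sqr_le; nra); fold C0; try lra.
Qed.

(** * Rotation to the eigenframe *)

(** The ordering of the diagonal entries is what later bounds the trace by twice the first entry. *)
Lemma rotation_diagonalises (a b c : R) :
  exists p q, p ^ 2 + q ^ 2 = 1 ^ 2 /\
    p * q * (c - a) + (p ^ 2 - q ^ 2) * b = 0 /\
    q ^ 2 * a - 2 * p * q * b + p ^ 2 * c <= p ^ 2 * a + 2 * p * q * b + q ^ 2 * c.
Proof.
  assert (H : exists p q, p ^ 2 + q ^ 2 = 1 ^ 2 /\
    p * q * (c - a) + (p ^ 2 - q ^ 2) * b = 0).
  { destruct (Req_dec b 0) as [->|Hb].
    { exists 1, 0. split; ring. }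
    set (D := sqrt (((a - c) / 2) ^ 2 + b ^ 2)).
    set (l := (a + c) / 2 + D).
    assert (Hb2 : 0 < b ^ 2) by nra.
    assert (HD : D ^ 2 = ((a - c) / 2) ^ 2 + b ^ 2).
    { unfold D. rewrite pow2_sqrt; [reflexivity|]. pose proof (pow2_ge_0 ((a - c) / 2)). lra. }
    assert (Hl : (l - a) * (l - c) = b ^ 2).
    { unfold l. replace (((a + c) / 2 + D - a) * ((a + c) / 2 + D - c))
        with (D ^ 2 - ((a - c) / 2) ^ 2) by field. rewrite HD. ring. }
    set (n2 := b ^ 2 + (l - a) ^ 2).
    assert (Hn : 0 < n2) by (unfold n2; pose proof (pow2_ge_0 (l - a)); lra).
    set (n := sqrt n2).
    assert (Hn0 : 0 < n) by now apply sqrt_lt_R0.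
    assert (Hnn : n ^ 2 = n2) by (unfold n; rewrite pow2_sqrt; lra).
    (* The vector [(b, l - a)] is an eigenvector for the larger eigenvalue [l]; it is nonzero
       because [b] is. *)
    exists (b / n), ((l - a) / n). split.
    - transitivity (n2 / n ^ 2); [unfold n2; field; lra|]. rewrite Hnn. field. lra.
    - transitivity (b * (b ^ 2 - (l - a) * (l - c)) / n ^ 2); [field; lra|].
      rewrite Hl. field. lra. }
  destruct H as (p & q & H1 & H2).
  destruct (Rle_dec (q ^ 2 * a - 2 * p * q * b + p ^ 2 * c)
    (p ^ 2 * a + 2 * p * q * b + q ^ 2 * c)) as [Hle|Hgt].
  - now exists p, q.
  (* A further quarter turn exchanges the two diagonal entries. *)
  - exists (- q), p. repeat apply conj; lra.
Qed.

Lemma continuity_2d_pt_pow (g : R -> R -> R) (n : nat) (x y : R) :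
  continuity_2d_pt g x y -> continuity_2d_pt (fun x y => g x y ^ n) x y.
Proof.
  intros H. apply (continuity_1d_2d_pt_comp (fun z => z ^ n)); [|exact H].
  apply derivable_continuous_pt, derivable_pt_pow.
Qed.

Lemma continuity_2d_pt_pos_part (g : R -> R -> R) (x y : R) :
  continuity_2d_pt g x y -> continuity_2d_pt (fun x y => Rmax 0 (g x y)) x y.
Proof.
  intros H.
  apply continuity_2d_pt_ext with (fun x y => (g x y + Rabs (g x y)) * / 2).
  { intros x' y'. destruct (Rle_dec 0 (g x' y')).
    - rewrite Rmax_right, Rabs_pos_eq by lra. field.
    - rewrite Rmax_left, Rabs_left by lra. field. }
  apply continuity_2d_pt_mult; [|apply continuity_2d_pt_const].
  apply continuity_2d_pt_plus; [exact H|].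
  apply (continuity_1d_2d_pt_comp Rabs); [apply Rcontinuity_abs|exact H].
Qed.

Lemma test_fn_continuous (C0 x y : R) (u1 u2 u11 u12 u22 : R -> R -> R) :
  continuity_2d_pt u1 x y -> continuity_2d_pt u2 x y ->
  continuity_2d_pt u11 x y -> continuity_2d_pt u12 x y -> continuity_2d_pt u22 x y ->
  u11 x y + u22 x y <> 0 -> continuity_2d_pt (test_fn C0 u1 u2 u11 u12 u22) x y.
Proof.
  intros H1 H2 H11 H12 H22 Hs.
  pose proof (continuity_2d_pt_id1 x y) as Hx. pose proof (continuity_2d_pt_id2 x y) as Hy.
  assert (Hsum : continuity_2d_pt (fun x y => u11 x y + u22 x y) x y)
    by now apply continuity_2d_pt_plus.
  assert (HQ : continuity_2d_pt (cof_quot u11 u12 u22) x y).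
  { unfold cof_quot, cof_num, Rdiv.
    apply continuity_2d_pt_mult; [|now apply continuity_2d_pt_inv].
    apply continuity_2d_pt_plus; [apply continuity_2d_pt_minus|].
    - apply continuity_2d_pt_mult; [exact H22|now apply continuity_2d_pt_pow].
    - repeat apply continuity_2d_pt_mult; auto. apply continuity_2d_pt_const.
    - apply continuity_2d_pt_mult; [exact H11|now apply continuity_2d_pt_pow]. }
  unfold test_fn.
  apply continuity_2d_pt_mult; [apply continuity_2d_pt_mult;
    [apply continuity_2d_pt_mult; [exact Hsum|]|]|].
  - apply continuity_2d_pt_pow, continuity_2d_pt_pos_part, continuity_2d_pt_minus;
      [apply continuity_2d_pt_const|exact HQ].
  - apply continuity_2d_pt_pow, continuity_2d_pt_pos_part, continuity_2d_pt_minus;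
      [apply continuity_2d_pt_const|].
    apply continuity_2d_pt_minus; [|exact HQ].
    apply continuity_2d_pt_plus; now apply continuity_2d_pt_pow.
  - apply (continuity_1d_2d_pt_comp exp); [apply derivable_continuous_pt, derivable_pt_exp|].
    apply continuity_2d_pt_mult; [apply continuity_2d_pt_const|].
    apply continuity_2d_pt_plus; now apply continuity_2d_pt_pow.
Qed.

Section Rotation.
Variables (p q : R).
Hypothesis Hpq : p ^ 2 + q ^ 2 = 1.
Variables u1 u2 u11 u12 u22 : R -> R -> R.

(** These are the derivatives appearing in [solution_sim] for [k = 1], spelled in the same way so
    that the rotation lemmas rewrite there. *)
Let v1 x y := p * sim 1 p q u1 x y + q * sim 1 p q u2 x y.
Let v2 x y := - q * sim 1 p q u1 x y + p * sim 1 p q u2 x y.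
Let v11 x y := p ^ 2 * sim 1 p q u11 x y + 2 * p * q * sim 1 p q u12 x y
                + q ^ 2 * sim 1 p q u22 x y.
Let v12 x y := p * q * (sim 1 p q u22 x y - sim 1 p q u11 x y)
                + (p ^ 2 - q ^ 2) * sim 1 p q u12 x y.
Let v22 x y := q ^ 2 * sim 1 p q u11 x y - 2 * p * q * sim 1 p q u12 x y
                + p ^ 2 * sim 1 p q u22 x y.

Lemma trace_rotation (x y : R) :
  v11 x y + v22 x y = u11 (p * x - q * y) (q * x + p * y)
                      + u22 (p * x - q * y) (q * x + p * y).
Proof.
  unfold v11, v22, sim.
  transitivity ((p ^ 2 + q ^ 2) * (u11 (p * x - q * y) (q * x + p * y)
                      + u22 (p * x - q * y) (q * x + p * y))); [ring|].
  rewrite Hpq. ring.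
Qed.

Lemma cof_quot_rotation (x y : R) :
  cof_quot v11 v12 v22 x y = cof_quot u11 u12 u22 (p * x - q * y) (q * x + p * y).
Proof.
  unfold cof_quot. rewrite trace_rotation. f_equal.
  unfold cof_num, v11, v12, v22, sim. ring.
Qed.

Lemma test_fn_rotation (C0 x y : R) :
  test_fn C0 v1 v2 v11 v12 v22 x y
  = test_fn C0 u1 u2 u11 u12 u22 (p * x - q * y) (q * x + p * y).
Proof.
  unfold test_fn. rewrite trace_rotation, cof_quot_rotation.
  set (X := p * x - q * y). set (Y := q * x + p * y).
  replace (x ^ 2 + y ^ 2) with (X ^ 2 + Y ^ 2).
  2:{ transitivity ((p ^ 2 + q ^ 2) * (x ^ 2 + y ^ 2)); [unfold X, Y; ring|].
      rewrite Hpq. ring. }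
  replace (v1 x y ^ 2 + v2 x y ^ 2) with (u1 X Y ^ 2 + u2 X Y ^ 2).
  2:{ transitivity ((p ^ 2 + q ^ 2) * (u1 X Y ^ 2 + u2 X Y ^ 2)); [rewrite Hpq; ring|].
      unfold v1, v2, sim. fold X Y. ring. }
  reflexivity.
Qed.

End Rotation.

Lemma exp_le_compat (x y : R) : x <= y -> exp x <= exp y.
Proof. intros [H| ->]; [left; now apply exp_increasing|right; reflexivity]. Qed.

(** * The bound at the centre of the unit disc *)

Lemma trace_bound (m M A B : R) :
  0 < m -> m <= M -> 0 <= A -> 0 <= B ->
  exists C : R, 0 < C /\
  forall K u f u1 u2 u11 u12 u22 f1 f2 f11 f12 f22,
  0 <= K ->
  solution 1 A B K m M u f u1 u2 u11 u12 u22 f1 f2 f11 f12 f22 ->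
  u11 0 0 + u22 0 0 <= C * (1 + K) ^ 2 * exp (73 / m / 2 * K ^ 2).
Proof.
  intros Hm HmM HA HB.
  destruct (diagonal_maximum_bound m M A B Hm HmM HA HB) as (eps & Heps & bound).
  (* Both cut-offs equal 1/8 at the origin, which gives [8^8]. At the maximum the trace is at most
     [2 lam]; of the four powers of [w v], two enter the bound on [lam (w v)^2] and the other two
     are at most 1. *)
  exists (2 * 8 ^ 8 / eps). split.
  { apply Rdiv_lt_0_compat; [|exact Heps]. apply Rmult_lt_0_compat; [lra|apply pow_lt; lra]. }
  intros K u f u1 u2 u11 u12 u22 f1 f2 f11 f12 f22 HK0 Hsol.
  set (C0 := 73 / m) in *.
  assert (HC0 : 0 < C0) by (apply Rdiv_lt_0_compat; lra).
  pose proof Hsol as [Cu Ju Cf Jf Hf Hdet Htr Hgrad Hhess HK].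
  set (phi := test_fn C0 u1 u2 u11 u12 u22).
  destruct (square_maximum (- (1 / 2)) (1 / 2) phi) as (x0 & y0 & Hx0 & Hy0 & Hmax).
  { lra. }
  { intros x y Hx Hy.
    assert (Hin : ball0 1 x y) by (unfold ball0; nra).
    destruct Ju as [J1 J2 J11 J12 J21 J22].
    pose proof (Ck_dx _ _ _ _ Cu J1) as C1. pose proof (Ck_dy _ _ _ _ Cu J2) as C2.
    pose proof (Ck_dx _ _ _ _ C1 J11) as C11. pose proof (Ck_dy _ _ _ _ C1 J12) as C12.
    pose proof (Ck_dy _ _ _ _ C2 J22) as C22.
    pose proof (Htr _ _ Hin).
    apply test_fn_continuous; try lra;
      (apply (cont_on_ball0 1); [eapply Ck_cont; eassumption|exact Hin]). }
  assert (H00 : ball0 1 0 0) by (unfold ball0; lra).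
  assert (Hphi0 : (u11 0 0 + u22 0 0) * (/ 8 ^ 8) <= phi 0 0).
  { unfold phi, test_fn.
    replace (cof_quot u11 u12 u22 0 0) with 0
      by (unfold cof_quot, cof_num, Rdiv; ring).
    replace (1 / 8 - 0) with (/ 8) by field.
    replace (1 / 8 - (0 ^ 2 + 0 ^ 2 - 0)) with (/ 8) by field.
    rewrite Rmax_right by lra.
    pose proof (Htr _ _ H00).
    rewrite Rmult_assoc, Rmult_assoc. apply Rmult_le_compat_l; [lra|].
    replace (/ 8 ^ 8) with ((/ 8) ^ 4 * ((/ 8) ^ 4 * 1)) by field.
    apply Rmult_le_compat_l; [apply pow_le; lra|].
    apply Rmult_le_compat_l; [apply pow_le; lra|].
    rewrite <- exp_0. apply exp_le_compat.
    apply Rmult_le_pos; [lra|]. pose proof (pow2_ge_0 (u1 0 0)).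
    pose proof (pow2_ge_0 (u2 0 0)). lra. }
  assert (H0max : phi 0 0 <= phi x0 y0) by (apply Hmax; lra).
  assert (Hphipos : 0 < phi x0 y0).
  { pose proof (Htr _ _ H00).
    assert (0 < (u11 0 0 + u22 0 0) * / 8 ^ 8).
    { apply Rmult_lt_0_compat; [lra|]. apply Rinv_0_lt_compat, pow_lt. lra. }
    lra. }
  set (Q := cof_quot u11 u12 u22 x0 y0).
  assert (Hwv : 0 < 1 / 8 - Q /\ 0 < 1 / 8 - (x0 ^ 2 + y0 ^ 2 - Q)).
  { unfold phi, test_fn in Hphipos. fold Q in Hphipos.
    split; apply Rnot_le_lt; intros Hle; rewrite (Rmax_left _ _ Hle) in Hphipos; lra. }
  destruct Hwv as [Hw Hv].
  (* The two positive cut-offs add up to [1/4 - |x|^2]. So the maximum over the square lies in the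
     inscribed disc of radius 1/2. *)
  assert (Hin : ball0 (1 / 2) x0 y0) by (unfold ball0; nra).
  pose proof (ball0_half_unit _ _ Hin) as Hin1.
  destruct (rotation_diagonalises (u11 x0 y0) (u12 x0 y0) (u22 x0 y0))
    as (p & q & Hpq & Hdiag & Hord).
  pose proof (solution_sim 1 p q A B K m M _ _ _ _ _ _ _ _ _ _ _ _ Rlt_0_1 Hpq Hsol)
    as Hrot. cbv zeta in Hrot.
  replace (/ 1 ^ 2) with 1 in Hrot by field.
  rewrite pow1 in Hpq.
  set (x1 := p * x0 + q * y0). set (y1 := - q * x0 + p * y0).
  assert (Ex : p * x1 - q * y1 = x0).
  { transitivity ((p ^ 2 + q ^ 2) * x0); [unfold x1, y1; ring|rewrite Hpq; ring]. }
  assert (Ey : q * x1 + p * y1 = y0).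
  { transitivity ((p ^ 2 + q ^ 2) * y0); [unfold x1, y1; ring|rewrite Hpq; ring]. }
  assert (Hnorm : forall x y, x ^ 2 + y ^ 2 = (p * x - q * y) ^ 2 + (q * x + p * y) ^ 2).
  { intros x y. transitivity ((p ^ 2 + q ^ 2) * (x ^ 2 + y ^ 2)); [rewrite Hpq|]; ring. }
  pose proof (bound K _ _ _ _ _ _ _ _ _ _ _ _ x1 y1 HK0 Hrot) as Hb.
  cbv zeta in Hb.
  rewrite (cof_quot_rotation p q Hpq u11 u12 u22 x1 y1), (Hnorm x1 y1), Ex, Ey in Hb.
  fold Q in Hb. unfold sim at 1 2 3 in Hb. rewrite !Rmult_1_l, Ex, Ey in Hb.
  set (w := 1 / 8 - Q) in *. set (v := 1 / 8 - (x0 ^ 2 + y0 ^ 2 - Q)) in *.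
  set (lam := p ^ 2 * u11 x0 y0 + 2 * p * q * u12 x0 y0 + q ^ 2 * u22 x0 y0) in *.
  assert (Hlam : eps * (lam * (w * v) ^ 2) <= (1 + K) ^ 2).
  { replace lam with (p ^ 2 * sim 1 p q u11 x1 y1 + 2 * p * q * sim 1 p q u12 x1 y1
      + q ^ 2 * sim 1 p q u22 x1 y1)
      by (unfold sim, lam; rewrite Ex, Ey; ring).
    apply Hb; try assumption.
    - unfold ball0 in *. pose proof (Hnorm x1 y1) as HN. rewrite Ex, Ey in HN. lra.
    - intros x y Hxy.
      rewrite !(test_fn_rotation p q Hpq), Ex, Ey. apply Hmax.
      + unfold ball0 in Hxy. pose proof (Hnorm x y) as HN.
        pose proof (pow2_ge_0 (q * x + p * y)). clear - Hxy HN H. split; nra.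
      + unfold ball0 in Hxy. pose proof (Hnorm x y) as HN.
        pose proof (pow2_ge_0 (p * x - q * y)). clear - Hxy HN H. split; nra. }
  assert (Hs2 : u11 x0 y0 + u22 x0 y0 <= 2 * lam).
  { assert (lam + (q ^ 2 * u11 x0 y0 - 2 * p * q * u12 x0 y0 + p ^ 2 * u22 x0 y0)
      = (p ^ 2 + q ^ 2) * (u11 x0 y0 + u22 x0 y0)) by (unfold lam; ring).
    rewrite Hpq in H. lra. }
  set (G := exp (C0 / 2 * K ^ 2)).
  assert (HG : 0 < G) by apply exp_pos.
  assert (Hwv2 : 0 <= (w * v) ^ 2 <= 1).
  { split; [apply pow2_ge_0|].
    assert (w + v <= 1 / 4).
    { unfold w, v. pose proof (pow2_ge_0 x0). pose proof (pow2_ge_0 y0). lra. }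
    assert (0 <= w * v <= 1) by (clear - Hw Hv H; split; nra). clear - H0; nra. }
  assert (Htr0 : 0 < u11 x0 y0 + u22 x0 y0) by now apply Htr.
  assert (Hphi : phi x0 y0 <= 2 * lam * (w * v) ^ 2 * G).
  { unfold phi, test_fn. fold Q. fold w. fold v. rewrite !Rmax_right by lra.
    apply Rmult_le_compat.
    - apply Rmult_le_pos; [apply Rmult_le_pos; [lra|]|]; apply pow_le; lra.
    - apply Rlt_le, exp_pos.
    - rewrite Rmult_assoc.
      replace (w ^ 4 * v ^ 4) with ((w * v) ^ 2 * (w * v) ^ 2) by ring.
      apply Rmult_le_compat; [lra|nonneg|exact Hs2|].
      clear - Hwv2; nra.
    - apply exp_le_compat, Rmult_le_compat_l; [lra|]. specialize (HK _ _ Hin1).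
      rewrite pow1 in HK. lra. }
  assert (Hfin : (u11 0 0 + u22 0 0) * / 8 ^ 8 <= 2 * ((1 + K) ^ 2 / eps) * G).
  { apply Rle_trans with (2 * (lam * (w * v) ^ 2) * G); [lra|].
    apply Rmult_le_compat_r; [lra|]. apply Rmult_le_compat_l; [lra|].
    apply Rmult_le_reg_l with eps; [exact Heps|].
    replace (eps * ((1 + K) ^ 2 / eps)) with ((1 + K) ^ 2) by (field; lra). exact Hlam. }
  assert (H88 : 0 < 8 ^ 8) by (apply pow_lt; lra).
  apply Rmult_le_reg_r with (/ 8 ^ 8); [now apply Rinv_0_lt_compat|].
  eapply Rle_trans; [exact Hfin|]. right. fold G. field. lra.
Qed.

(** * Convexity, matrix norms and the general disc *)

(** By midpoint convexity [- (u (x + t) y + u (x - t) y)] is maximal at [t = 0], where its second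
    derivative is [- 2 uxx]. *)
Lemma convex_second_derivative (r : R) (u ux uxx : R -> R -> R) :
  convex_on (ball0 r) u -> dx_on (ball0 r) u ux -> dx_on (ball0 r) ux uxx ->
  forall x y, ball0 r x y -> 0 <= uxx x y.
Proof.
  intros Hconv Hx Hxx x y Hxy.
  assert (Hloc : locally 0 (fun t => ball0 r (x + t) y /\ ball0 r (x - t) y)).
  { destruct (ball0_locally_x _ _ _ Hxy) as [d Hd]. exists d. intros t Ht.
    change (Rabs (t - 0) < d) in Ht.
    split; apply Hd; [change (Rabs (x + t - x) < d)|change (Rabs (x - t - x) < d)].
    - replace (x + t - x) with (t - 0) by ring. exact Ht.
    - replace (x - t - x) with (- (t - 0)) by ring. rewrite Rabs_Ropp. exact Ht. }
  assert (Dp : forall (g g' : R -> R -> R) t, dx_on (ball0 r) g g' -> ball0 r (x + t) y ->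
    is_derive (fun t => g (x + t) y) t (g' (x + t) y)).
  { intros g g' t Hg Ht. evar_last.
    - apply (is_derive_comp (fun z => g z y) (fun t => x + t)).
      + apply is_derive_Reals, Hg, Ht.
      + apply is_derive_Rplus; [apply is_derive_Rconst|apply is_derive_Rid].
    - rewrite Rplus_0_l. apply Rmult_1_l. }
  assert (Dm : forall (g g' : R -> R -> R) t, dx_on (ball0 r) g g' -> ball0 r (x - t) y ->
    is_derive (fun t => g (x - t) y) t (- g' (x - t) y)).
  { intros g g' t Hg Ht. evar_last.
    - apply (is_derive_comp (fun z => g z y) (fun t => x - t)).
      + apply is_derive_Reals, Hg, Ht.
      + apply is_derive_Rminus; [apply is_derive_Rconst|apply is_derive_Rid].
    - change (scal (0 - 1) (g' (x - t) y)) with ((0 - 1) * g' (x - t) y). ring. }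
  destruct (second_derivative_test
    (fun t => 0 - (u (x + t) y + u (x - t) y))
    (fun t => 0 - (ux (x + t) y - ux (x - t) y)) 0 (0 - (uxx x y - - uxx x y))) as [_ H].
  - revert Hloc. apply filter_imp. intros t [H1 H2].
    pose proof (Hconv _ _ _ _ (1 / 2) H1 H2 ltac:(lra)) as Hc.
    replace (1 / 2 * (x + t) + (1 - 1 / 2) * (x - t)) with x in Hc by field.
    replace (1 / 2 * y + (1 - 1 / 2) * y) with y in Hc by field.
    rewrite Rplus_0_r, Rminus_0_r. lra.
  - revert Hloc. apply filter_imp. intros t [H1 H2].
    apply is_derive_Rminus; [apply is_derive_Rconst|].
    apply is_derive_Rplus; [now apply Dp|now apply Dm].
  - pose proof (locally_singleton _ _ Hloc) as [H1 H2].
    apply is_derive_Rminus; [apply is_derive_Rconst|]. apply is_derive_Rminus.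
    + pose proof (Dp ux uxx 0 Hxx H1) as D. now rewrite Rplus_0_r in D.
    + pose proof (Dm ux uxx 0 Hxx H2) as D. now rewrite Rminus_0_r in D.
  - lra.
Qed.

Lemma sym_max_eig_le_trace (a b c : R) :
  0 <= a + c -> 0 <= a * c - b ^ 2 -> sym_max_eig a b c <= a + c.
Proof.
  intros Ht Hd. unfold sym_max_eig.
  assert (sqrt (((a - c) / 2) ^ 2 + b ^ 2) <= (a + c) / 2); [|lra].
  rewrite <- (sqrt_pow2 ((a + c) / 2)) by lra. apply sqrt_le_1_alt. nra.
Qed.

(** The eigenvalues are [(a + c) / 2] plus or minus the root [D], so the left side is
    [2 (T^2 + D^2)], at most [2 (T + D)^2]. *)
Lemma frobenius_le_op_norm (a b c : R) :
  a ^ 2 + 2 * b ^ 2 + c ^ 2 <= 2 * sym_op_norm a b c ^ 2.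
Proof.
  unfold sym_op_norm.
  set (T := Rabs ((a + c) / 2)). set (D := sqrt (((a - c) / 2) ^ 2 + b ^ 2)).
  assert (HT : T ^ 2 = ((a + c) / 2) ^ 2) by apply pow2_abs.
  assert (HD : D ^ 2 = ((a - c) / 2) ^ 2 + b ^ 2).
  { apply pow2_sqrt. pose proof (pow2_ge_0 ((a - c) / 2)). pose proof (pow2_ge_0 b). lra. }
  assert (0 <= T) by apply Rabs_pos. assert (0 <= D) by apply sqrt_pos.
  assert (0 <= T * D) by now apply Rmult_le_pos.
  replace (a ^ 2 + 2 * b ^ 2 + c ^ 2)
    with (2 * (((a + c) / 2) ^ 2 + (((a - c) / 2) ^ 2 + b ^ 2))) by field.
  rewrite <- HT, <- HD. nra.
Qed.

Theorem theorem1p1 :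
  forall m M : R, 0 < m -> m <= M ->
  exists C2 : R, 0 < C2 /\
  forall A B : R,
  exists C1 : R, 0 < C1 /\
  forall (r : R) (u f ux uy uxx uxy uyy fx fy fxx fxy fyy : R -> R -> R) (K : R),
    0 < r ->
    Ck 4 (ball0 r) u -> convex_on (ball0 r) u ->
    Ck 2 (ball0 r) f ->
    dx_on (ball0 r) u ux -> dy_on (ball0 r) u uy ->
    dx_on (ball0 r) ux uxx -> dy_on (ball0 r) ux uxy -> dy_on (ball0 r) uy uyy ->
    dx_on (ball0 r) f fx -> dy_on (ball0 r) f fy ->
    dx_on (ball0 r) fx fxx -> dy_on (ball0 r) fx fxy -> dy_on (ball0 r) fy fyy ->
    (forall x y, ball0 r x y -> m <= f x y <= M) ->
    (forall x y, ball0 r x y -> uxx x y * uyy x y - uxy x y ^ 2 = f x y) ->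
    (forall x y, ball0 r x y -> r * sqrt (fx x y ^ 2 + fy x y ^ 2) <= A) ->
    (forall x y, ball0 r x y -> r ^ 2 * sym_op_norm (fxx x y) (fxy x y) (fyy x y) <= B) ->
    (forall x y, ball0 r x y -> sqrt (ux x y ^ 2 + uy x y ^ 2) <= K) ->
    sym_max_eig (uxx 0 0) (uxy 0 0) (uyy 0 0) <= C1 * exp (C2 * (K ^ 2 / r ^ 2)).
Proof.
  intros m M Hm HmM.
  (* The summand 1 absorbs the polynomial factor of [trace_bound], since [(1 + K/r)^2 <= 2 (1 +
     K^2/r^2) <= 2 exp (K^2/r^2)]. *)
  exists (73 / m / 2 + 1). split.
  { assert (0 < 73 / m) by (apply Rdiv_lt_0_compat; lra). lra. }
  intros A B.
  (* [A] and [B] are arbitrary reals, hence the absolute values; the factor 2 covers the [sqrt 2]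
     lost between the operator and Frobenius norms. *)
  destruct (trace_bound m M (Rabs A) (2 * Rabs B) Hm HmM) as (C & HC & bound).
  { apply Rabs_pos. }
  { pose proof (Rabs_pos B). lra. }
  exists (2 * C). split; [lra|].
  intros r u f ux uy uxx uxy uyy fx fy fxx fxy fyy K Hr Cu Hconv Cf
    Hux Huy Huxx Huxy Huyy Hfx Hfy Hfxx Hfxy Hfyy Hf Hdet HA HB HK.
  assert (H0 : ball0 r 0 0) by (unfold ball0; nra).
  assert (HK0 : 0 <= K).
  { eapply Rle_trans; [apply sqrt_pos|apply (HK 0 0 H0)]. }
  assert (Hr2 : 0 < r ^ 2) by now apply pow_lt.
  (* Convexity enters as [uxx >= 0]; the determinant being at least [m > 0] then makes both [uxx]
     and [uyy] positive. *)
  assert (Htr : forall x y, ball0 r x y -> 0 < uxx x y + uyy x y).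
  { intros x y Hxy. pose proof (convex_second_derivative r u ux uxx Hconv Hux Huxx x y Hxy).
    pose proof (Hdet x y Hxy). pose proof (Hf x y Hxy).
    pose proof (pow2_ge_0 (uxy x y)).
    assert (0 < uxx x y * uyy x y) by lra. nra. }
  assert (Hsol : solution r (Rabs A) (2 * Rabs B) (K / r) m M
    u f ux uy uxx uxy uyy fx fy fxx fxy fyy).
  { split; try assumption.
    - apply jet2_intro; try assumption. now do 2 apply Ck_pred.
    - now apply jet2_intro.
    - intros x y Hxy. specialize (HA x y Hxy).
      set (g := sqrt (fx x y ^ 2 + fy x y ^ 2)) in *.
      assert (Hg : g ^ 2 = fx x y ^ 2 + fy x y ^ 2).
      { apply pow2_sqrt. pose proof (pow2_ge_0 (fx x y)).
        pose proof (pow2_ge_0 (fy x y)). lra. }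
      rewrite <- Hg, pow2_abs, <- Rpow_mult_distr. apply pow_incr.
      split; [|exact HA]. apply Rmult_le_pos; [lra|apply sqrt_pos].
    - intros x y Hxy. specialize (HB x y Hxy).
      pose proof (frobenius_le_op_norm (fxx x y) (fxy x y) (fyy x y)) as HF.
      set (n := sym_op_norm (fxx x y) (fxy x y) (fyy x y)) in *.
      assert (Hn : 0 <= n).
      { unfold n, sym_op_norm. apply Rplus_le_le_0_compat; [apply Rabs_pos|apply sqrt_pos]. }
      assert (HB2 : (r ^ 2 * n) ^ 2 <= B ^ 2).
      { apply pow_incr. split; [|exact HB]. apply Rmult_le_pos; lra. }
      assert (Hr4 : 0 <= r ^ 4) by (apply pow_le; lra).
      rewrite Rpow_mult_distr, pow2_abs.
      apply (Rmult_le_compat_l _ _ _ Hr4) in HF.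
      replace (r ^ 4 * (2 * n ^ 2)) with (2 * (r ^ 2 * n) ^ 2) in HF by ring.
      pose proof (pow2_ge_0 B). lra.
    - intros x y Hxy. specialize (HK x y Hxy).
      replace ((K / r) ^ 2 * r ^ 2) with (K ^ 2) by (field; lra).
      rewrite <- (pow2_sqrt (ux x y ^ 2 + uy x y ^ 2)).
      2:{ pose proof (pow2_ge_0 (ux x y)). pose proof (pow2_ge_0 (uy x y)). lra. }
      apply pow_incr. split; [apply sqrt_pos|exact HK]. }
  assert (Hpq : r ^ 2 + 0 ^ 2 = r ^ 2) by ring.
  pose proof (solution_sim r r 0 _ _ _ _ _ _ _ _ _ _ _ _ _ _ _ _ _ Hr Hpq Hsol) as Hunit.
  cbv zeta in Hunit.
  assert (HKr : 0 <= K / r).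
  { apply Rmult_le_pos; [exact HK0|]. now apply Rlt_le, Rinv_0_lt_compat. }
  pose proof (bound (K / r) _ _ _ _ _ _ _ _ _ _ _ _ HKr Hunit) as Hb.
  unfold sim in Hb. cbv beta in Hb.
  replace (r * 0 - 0 * 0) with 0 in Hb by ring.
  replace (0 * 0 + r * 0) with 0 in Hb by ring.
  set (k2 := (K / r) ^ 2) in *.
  assert (Hk2 : K ^ 2 / r ^ 2 = k2) by (unfold k2; field; lra).
  rewrite Hk2.
  apply Rle_trans with (uxx 0 0 + uyy 0 0).
  { apply sym_max_eig_le_trace.
    - now apply Rlt_le, Htr.
    - rewrite Hdet by assumption. specialize (Hf 0 0 H0). lra. }
  eapply Rle_trans; [|eapply Rle_trans; [exact Hb|]].
  { right. field. lra. }
  rewrite Rmult_plus_distr_r, exp_plus, Rmult_1_l.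
  assert (Hsq : (1 + K / r) ^ 2 <= 2 * exp k2).
  { pose proof (exp_ineq1_le k2). pose proof (pow2_ge_0 (1 - K / r)).
    unfold k2 in *. nra. }
  set (G := exp (73 / m / 2 * k2)). assert (HG : 0 < G) by apply exp_pos.
  apply Rle_trans with (C * (2 * exp k2) * G); [|right; ring].
  apply Rmult_le_compat_r; [lra|]. apply Rmult_le_compat_l; lra.
Qed.
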